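(* Let $G$ be a connected Lie group with Lie algebra $\mathfrak{g}=T_eG$, and let $F$ be a left-invariant Finsler metric on $G$. Then $X\in\mathfrak{g}\setminus\{0\}$ is a geodesic vector of $F$ if and only if $$g_X(X,[X,Z])=0\qquad\text{for every } Z\in\mathfrak{g}.$$
   Context: A Finsler metric on a manifold $M$ is a continuous function $F:TM\to[0,\infty)$ that is $C^\infty$ on $TM\setminus\{0\}$, satisfies $F(tu)=tF(u)$ for all $t\ge 0$, $u\in TM$ (only positive homogeneity; reversibility is not assumed), and is such that for each $x\in M$ and $y\in T_xM\setminus\{0\}$ the symmetric bilinear form $$g_y(u,v)=\frac12\frac{\partial^2}{\partial s\,\partial t}\left[F^2(x,y+su+tv)\right]\Big|_{s=t=0},\quad u,v\in T_xM,$$ is positive definite. A Finsler metric $F$ on a Lie group $G$ is left-invariant if $F(gx,(L_g)_*u)=F(x,u)$ for all $g,x\in G$, $u\in T_xG$, where $L_g$ is left translation; such $F$ correspond bijectively to their restrictions to $T_eG=\mathfrak g$ (Minkowski norms on $\mathfrak{g}$). In the claim, $g_X$ for $X\in\mathfrak g\setminus\{0\}$ is the symmetric bilinear form $g_y$ with $x=e$ (the identity) and $y=X$, i.e. $$g_X(u,v)=\frac12\frac{\partial^2}{\partial s\,\partial t}\left[F^2(e,X+su+tv)\right]\Big|_{s=t=0},\quad u,v\in\mathfrak g.$$ Geodesics of $F$ are parametrized with constant speed $F(\dot\sigma)$: a curve $\sigma$ with velocity $T=\dot\sigma\neq 0$ is a geodesic if $D_TT=0$ with reference vector $T$, i.e.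 in local coordinates $\ddot\sigma^i+\dot\sigma^j\dot\sigma^k\,\Gamma^i_{jk}(\sigma,\dot\sigma)=0$, where $\Gamma^i_{jk}(x,y)$ are the coefficients of the Chern connection of $F$. A vector $X\in\mathfrak g\setminus\{0\}$ is a geodesic vector if the curve $t\mapsto\exp(tX)$, $t\in\mathbb{R}_+=[0,\infty)$, is a geodesic of $F$. *)

(* Defs.v *)
From HB Require Import structures.
From mathcomp Require Import all_boot all_order all_algebra.
From mathcomp Require Import all_classical all_reals all_analysis.

Set Implicit Arguments.
Unset Strict Implicit.
Unset Printing Implicit Defensive.

Import Order.TTheory GRing.Theory Num.Theory.
Import numFieldNormedType.Exports.

Local Open Scope ring_scope.
Local Open Scope classical_set_scope.

(** * Smooth maps between open subsets of normed spaces *)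

(* Meant for [U] open and [V] finite-dimensional: then asking that
   [x |-> 'd f x v] be C^k for every fixed [v] is the same as asking that
   [x |-> 'd f x] be C^k. *)
Fixpoint Ck_on (R : realType) (V W : normedModType R) (k : nat)
    (U : set V) (f : V -> W) : Prop :=
  match k with
  | 0 => forall x, U x -> {for x, continuous f}
  | k'.+1 => (forall x, U x -> differentiable f x) /\
             (forall v, Ck_on k' U (fun x => 'd f x v))
  end.

Definition smooth_on (R : realType) (V W : normedModType R)
    (U : set V) (f : V -> W) : Prop :=
  forall k, Ck_on k U f.

(** * Smooth manifolds *)

Record chart (R : realType) (n : nat) (M : topologicalType) := Chart {
  chart_map :> M -> 'rV[R]_n ;
  chart_inv : 'rV[R]_n -> M ;
  chart_dom : set M ;
  open_chart_dom : open chart_dom ;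
  open_chart_image : open (chart_map @` chart_dom) ;
  chart_mapK : forall x, chart_dom x -> chart_inv (chart_map x) = x ;
  chart_map_continuous :
    forall x, chart_dom x -> {for x, continuous chart_map} ;
  chart_inv_continuous :
    forall p, (chart_map @` chart_dom) p -> {for p, continuous chart_inv} }.

Definition chart_codom (R : realType) (n : nat) (M : topologicalType)
    (c : chart R n M) : set 'rV[R]_n :=
  c @` chart_dom c.

(* [atlas] need not be maximal.  [chart_at x] is a preferred chart of the atlas
   around [x]; it is only used to write down tangent spaces, see [tangent]. *)
HB.mixin Record isManifold (R : realType) (n : nat) M of Topological M := {
  atlas : set (chart R n M) ;
  chart_at : M -> chart R n M ;
  chart_at_atlas : forall x, atlas (chart_at x) ;
  chart_at_dom : forall x, chart_dom (chart_at x) x ;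
  atlas_compatible : forall c d : chart R n M, atlas c -> atlas d ->
    smooth_on [set p | chart_codom c p /\ chart_dom d (chart_inv c p)]
              (d \o chart_inv c) ;
  manifold_hausdorff : hausdorff_space M ;
  manifold_second_countable : @second_countable M
}.

#[short(type="manifoldType")]
HB.structure Definition Manifold (R : realType) (n : nat) :=
  { M of isManifold R n M & Topological M }.

Arguments atlas {R n s}.
Arguments chart_at {R n s}.

(* Every tangent vector at [x] has unique coordinates in the chart
   [chart_at x]; T_x M is identified with R^n in this way.  Coordinates in the
   other charts around [x] are then given by [vec_to_coord]. *)
Definition tangent (R : realType) (n : nat) (M : manifoldType R n) (x : M) :
    normedModType R :=
  'rV[R]_n.

Section Tangent.
Context (R : realType) (n : nat) (M : manifoldType R n).

Definition vec_to_coord (c : chart R n M) (x : M) (u : tangent x) : 'rV[R]_n :=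
  'd (c \o chart_inv (chart_at x)) (chart_at x x) u.

Definition vec_of_coord (c : chart R n M) (x : M) (y : 'rV[R]_n) : tangent x :=
  'd (chart_at x \o chart_inv c) (c x) y.

Definition tangent_map (f : M -> M) (x : M) (u : tangent x) : tangent (f x) :=
  'd (chart_at (f x) \o f \o chart_inv (chart_at x)) (chart_at x x) u.

Definition smooth_curve_on (J : set R) (sigma : R -> M) : Prop :=
  (forall t, J t -> {for t, continuous sigma}) /\
  (forall c, atlas c ->
     smooth_on (J `&` sigma @^-1` chart_dom c) (c \o sigma)).

Definition velocity (sigma : R -> M) (t : R) : tangent (sigma t) :=
  derive1 (chart_at (sigma t) \o sigma) t.

(* The bracket [V, W] = VW - WV of derivations, computed at [x] in the chart
   [chart_at x]: its i-th coordinate is V^j d_j W^i - W^j d_j V^i. *)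
Definition bracket_field (V W : forall x : M, tangent x) (x : M) : tangent x :=
  let c := chart_at x in
  let V' := fun p => vec_to_coord c (V (chart_inv c p)) in
  let W' := fun p => vec_to_coord c (W (chart_inv c p)) in
  'D_(V' (c x)) W' (c x) - 'D_(W' (c x)) V' (c x).

End Tangent.

(** * Finsler metrics *)

Section Finsler.
Context (R : realType) (n : nat) (M : manifoldType R n).
Variable F : forall x : M, tangent x -> R.

(* The expression F(x, y) of the metric in the coordinates (x^i, y^i) that a
   chart of [M] induces on TM. *)
Definition coord_metric (c : chart R n M) (p : 'rV[R]_n * 'rV[R]_n) : R :=
  F (vec_of_coord c (chart_inv c p.1) p.2).

(* g_y(u, v) *)
Definition fundamental_form (x : M) (y u v : tangent x) : R :=
  2^-1 * derive1 (fun s : R =>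
           derive1 (fun t : R => F (y + s *: u + t *: v) ^+ 2) 0) 0.

Record is_finsler : Prop := IsFinsler {
  finsler_ge0 : forall (x : M) (u : tangent x), 0 <= F u ;
  finsler_continuous : forall c, atlas c -> forall p,
    chart_codom c p.1 -> {for p, continuous (coord_metric c)} ;
  finsler_smooth : forall c, atlas c ->
    smooth_on [set p | chart_codom c p.1 /\ p.2 != 0] (coord_metric c) ;
  finsler_homogeneous : forall (x : M) (u : tangent x) (t : R),
    0 <= t -> F (t *: u) = t * F u ;
  finsler_posdef : forall (x : M) (y u : tangent x),
    y != 0 -> u != 0 -> 0 < fundamental_form y u u }.

Section ChernConnection.
Variable c : chart R n M.
Implicit Types (i j k l : 'I_n) (p : 'rV[R]_n * 'rV[R]_n).

Definition dx i : 'rV[R]_n * 'rV[R]_n := (delta_mx 0 i, 0).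
Definition dy i : 'rV[R]_n * 'rV[R]_n := (0, delta_mx 0 i).

Definition coord_metric2 p : R := coord_metric c p ^+ 2.

(* g_ij = 1/2 [F^2]_{y^i y^j} *)
Definition fundamental_mx p : 'M[R]_n :=
  \matrix_(i, j) (2^-1 * 'D_(dy i) ('D_(dy j) coord_metric2) p).

(* G^i = 1/4 g^il ([F^2]_{x^k y^l} y^k - [F^2]_{x^l}) *)
Definition spray_coef i p : R :=
  4^-1 * \sum_l invmx (fundamental_mx p) i l *
    (\sum_k 'D_(dx k) ('D_(dy l) coord_metric2) p * p.2 0 k
     - 'D_(dx l) coord_metric2 p).

(* N^i_j = d G^i / d y^j *)
Definition nonlinear_connection i j p : R := 'D_(dy j) (spray_coef i) p.

(* delta_k = d/dx^k - N^m_k d/dy^m *)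
Definition horizontal_derive k (f : 'rV[R]_n * 'rV[R]_n -> R) p : R :=
  'D_(dx k) f p - \sum_m nonlinear_connection m k p * 'D_(dy m) f p.

(* The Chern connection (torsion-free, almost g-compatible) in natural
   coordinates:
   Gamma^i_jk = 1/2 g^il (delta_j g_lk + delta_k g_jl - delta_l g_jk) *)
Definition chern_coef i j k p : R :=
  2^-1 * \sum_l invmx (fundamental_mx p) i l *
    (horizontal_derive j (fun q => fundamental_mx q l k) p
     + horizontal_derive k (fun q => fundamental_mx q j l) p
     - horizontal_derive l (fun q => fundamental_mx q j k) p).

End ChernConnection.

(* The set [I] of parameters may have end points; derivatives there are those of
   [sigma] on an open neighbourhood [J] of [I]. *)
Definition is_geodesic_on (I : set R) (sigma : R -> M) : Prop :=
  (exists J : set R, [/\ open J, I `<=` J & smooth_curve_on J sigma]) /\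
  (forall t, I t ->
     velocity sigma t != 0 /\
     forall c, atlas c -> chart_dom c (sigma t) ->
       let x := c \o sigma in
       let x' := derive1 x in
       let x'' := derive1 x' in
       forall i,
         x'' t 0 i
         + \sum_j \sum_k x' t 0 j * x' t 0 k
                         * chern_coef c i j k (x t, x' t) = 0).

End Finsler.

(** * Lie groups *)

HB.mixin Record isLieGroup (R : realType) (n : nat) G
    of Manifold R n G & Group G := {
  mulg_continuous : continuous (fun z : G * G => (z.1 * z.2)%g) ;
  mulg_smooth : forall c1 c2 c3 : chart R n G,
    atlas c1 -> atlas c2 -> atlas c3 ->
    smooth_on
      [set p : 'rV[R]_n * 'rV[R]_n |
        [/\ chart_codom c1 p.1, chart_codom c2 p.2 &
            chart_dom c3 (chart_inv c1 p.1 * chart_inv c2 p.2)%g]]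
      (fun p => c3 (chart_inv c1 p.1 * chart_inv c2 p.2)%g) ;
  invg_continuous : continuous (fun z : G => (z^-1)%g) ;
  invg_smooth : forall c1 c2 : chart R n G, atlas c1 -> atlas c2 ->
    smooth_on
      [set p | chart_codom c1 p /\ chart_dom c2 ((chart_inv c1 p)^-1)%g]
      (fun p => c2 ((chart_inv c1 p)^-1)%g)
}.

#[short(type="lieGroupType")]
HB.structure Definition LieGroup (R : realType) (n : nat) :=
  { G of isLieGroup R n G & Manifold R n G & Group G }.

Definition lie_algebra (R : realType) (n : nat) (G : lieGroupType R n) :
    normedModType R :=
  tangent (1%g : G).

Section LieGroup.
Context (R : realType) (n : nat) (G : lieGroupType R n).

Definition left_translation (g x : G) : G := (g * x)%g.

(* [tangent_map] lands in the tangent space at [x * 1], which is the tangent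
   space at [x]. *)
Definition left_invariant_field (X : lie_algebra G) (x : G) : tangent x :=
  tangent_map (left_translation x) (X : tangent (1%g : G)).

Definition lie_bracket (X Y : lie_algebra G) : lie_algebra G :=
  bracket_field (left_invariant_field X) (left_invariant_field Y) 1%g.

Definition one_parameter_subgroup (X : lie_algebra G) (gamma : R -> G) : Prop :=
  [/\ smooth_curve_on setT gamma,
      forall s t, gamma (s + t) = (gamma s * gamma t)%g
    & velocity gamma 0 = X].

(* The value at 1 of the one-parameter subgroup with initial velocity [X],
   which exists and is unique; the default value of [xget] is not used. *)
Definition lie_exp (X : lie_algebra G) : G :=
  xget 1%g [set gamma 1 | gamma in one_parameter_subgroup X].

Definition left_invariant (F : forall x : G, tangent x -> R) : Prop :=
  forall (g x : G) (u : tangent x),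
    F _ (tangent_map (left_translation g) u) = F x u.

Definition is_geodesic_vector (F : forall x : G, tangent x -> R)
    (X : lie_algebra G) : Prop :=
  is_geodesic_on F `[0, +oo[ (fun t : R => lie_exp (t *: X)).

End LieGroup.

(* Main.v *)
Require Import Defs.
From HB Require Import structures.
From mathcomp Require Import all_boot all_order all_algebra.
From mathcomp Require Import all_classical all_reals all_analysis.
From mathcomp Require Import ring lra.

Set Implicit Arguments.
Unset Strict Implicit.
Unset Printing Implicit Defensive.

Import Order.TTheory GRing.Theory Num.Theory.
Import numFieldNormedType.Exports.

Local Open Scope ring_scope.
Local Open Scope classical_set_scope.

(** Why the theorem holds.  Write L for F^2, and V_Z for the left-invariant
    vector field of Z.

    Geodesics are the extremals of L.  Since [F^2]_(y^l) is homogeneous of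
    degree 1 in y, Euler's identity gives g_kl y^k = [F^2]_(y^l) / 2; when the
    Chern coefficients are contracted twice with y, this removes the part of
    the horizontal derivatives that involves the nonlinear connection, and
    Gamma^i_jk y^j y^k = 2 G^i remains ([chern_contract]).  As g_kl is
    invertible, the geodesic equation says that the covector
    EL_l = d/dt (L_(y^l)) - L_(x^l) vanishes ([geodesic_equationP]).

    Invariance of F says that L(p, V_W(p)) is independent of p, for every W.  Two
    consequences suffice.  For W = X the derivative along V_Z vanishes:
    L_x . V_Z + L_y . D_(V_Z) V_X = 0.  And the derivative with respect to W, at X
    and in the direction of Z, is L_y(p, V_X(p)) . V_Z(p); it is again independent
    of p, so that it is constant along an integral curve of V_X.  Subtracting,
    EL . V_Z = - L_y . [V_X, V_Z] on integral curves of V_X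
    ([euler_lagrange_left_field]); here [V_X, V_Z] = V_([X, Z]) because left
    translations relate left-invariant fields and brackets of related fields are
    related ([related_bracket]).  Hence EL . V_Z equals - L_y(1, X) . [X, Z], that
    is - 2 g_X(X, [X, Z]), at every point of the curve.  The vectors V_Z(p) fill
    the tangent space at p, so the curve is a geodesic exactly when
    g_X(X, [X, Z]) = 0 for all Z ([euler_lagrange_bracketP]).

    It remains to know that t |-> exp(tX) is a smooth integral curve of V_X.  A
    solution of x' = V_X(x) near the unit comes from Picard iteration
    ([local_solution_exists]); by uniqueness ([solution_unique]) it is a
    homomorphism for small times, which extends to the whole line by taking
    powers ([local_homomorphism_extends], [flow_subgroup_exists]).  A homomorphism
    that is differentiable at 0 is smooth, because every derivative of a smooth
    function along it is again a smooth function along it ([smooth_flow]). *)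

(** * Limits and metric estimates *)

Lemma near_dist_le {R : realType} {V W : normedModType R} (g : V -> W) (x : V) (e : R) :
  {for x, continuous g} -> 0 < e -> \forall y \near x, `|g x - g y| <= e.
Proof. by move=> cg e0; have /cvgrPdist_le/(_ _ e0) := cg. Qed.

Lemma near_norm_lt {R : realType} {V W : normedModType R} (f : V -> W) (x : V) (u : R) :
  {for x, continuous f} -> `|f x| < u -> \forall y \near x, `|f y| < u.
Proof. by move=> cf fu; exact: (cvgr_norm_lt _ cf _ fu). Qed.

Lemma near_norm_ball {R : realType} {V : normedModType R} (x : V) (P : set V) :
  nbhs x P -> exists2 d : R, 0 < d & forall y, `|y - x| < d -> P y.
Proof.
by move=> /nbhs_normP[d /= d0 H]; exists d => // y yx; apply: H; rewrite /ball_ /= distrC.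
Qed.

(** * Maps of class C^k *)

Section Germs.
Context {R : realType} {V W : normedModType R}.

Lemma near_eq_diff (f g : V -> W) (x : V) :
  (\near x, f x = g x) -> differentiable f x ->
  differentiable g x /\ ('d g x = 'd f x :> (V -> W)).
Proof.
move=> fg df.
have fgx : f x = g x by exact: (nbhs_singleton fg).
have dfc : continuous ('d f x) by exact: diff_continuous.
have H : g \o shift x = cst (g x) + 'd f x +o_0 id.
  apply/eqaddoP => e e0.
  have [_ /eqaddoP/(_ e e0) H] := (diff_locallyP x f).1 df.
  have fg' : \forall h \near (0 : V), f (h + x) = g (h + x).
    by move: fg; rewrite (near_shift 0) /=; apply: filterS => h /=; rewrite subr0.
  near=> h.
  have -> : (g \o shift x - (cst (g x) + 'd f x)) h =
            (f \o shift x - (cst (f x) + 'd f x)) h.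
    rewrite /= !fctE /= fgx; congr (_ - _).
    by symmetry; near: h.
  by near: h.
have dg : 'd g x = 'd f x :> (V -> W) by exact: diff_unique.
split=> //; apply/diff_locallyP; split; first by rewrite dg.
by rewrite dg.
Unshelve. all: by end_near. Qed.

Lemma open_eq_near (U : set V) (f g : V -> W) (x : V) :
  open U -> (forall y, U y -> f y = g y) -> U x -> \near x, f x = g x.
Proof.
move=> oU fg Ux; have := open_nbhs_nbhs (conj oU Ux).
by apply: filterS => y; exact: fg.
Qed.

(** Differentials at points of an open set depend only on the values on that
    set; this lets a differential be replaced by a formula that is valid on [U]
    only. *)
Lemma Ck_on_eq (k : nat) (U : set V) : open U -> forall f g : V -> W,
  (forall x, U x -> f x = g x) -> Ck_on k U f -> Ck_on k U g.
Proof.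
move=> oU; elim: k => [|k IH] f g fg /=.
  move=> cf x Ux.
  have nfg := open_eq_near oU fg Ux.
  move=> A /=; rewrite -(fg _ Ux) => /(cf _ Ux) /=.
  rewrite !nbhs_simpl/= => fA.
  by apply: filterS2 nfg fA => y /= ->.
move=> [df ddf].
have Hd x : U x -> _ := fun Ux => near_eq_diff (open_eq_near oU fg Ux) (df x Ux).
split=> [x /Hd[]//|v].
by apply: IH (ddf v) => x Ux; have [_ ->] := Hd _ Ux.
Qed.

Lemma Ck_on_sub (k : nat) (U U' : set V) (f : V -> W) :
  U' `<=` U -> Ck_on k U f -> Ck_on k U' f.
Proof.
move=> sU; elim: k f => [|k IH] f /=; first by move=> cf x /sU /cf.
by move=> [df ddf]; split=> [x /sU/df//|v]; exact: IH.
Qed.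

Lemma Ck_onW (k : nat) (U : set V) (f : V -> W) : Ck_on k.+1 U f -> Ck_on k U f.
Proof.
elim: k f => [|k IH] f [df ddf].
  by move=> x Ux; apply: differentiable_continuous; exact: df.
by split=> // v; exact: IH.
Qed.

Lemma Ck_onD (k : nat) (U : set V) (f g : V -> W) : open U ->
  Ck_on k U f -> Ck_on k U g -> Ck_on k U (fun x => f x + g x).
Proof.
move=> oU; elim: k f g => [|k IH] f g /=.
  by move=> cf cg x Ux; apply: cvgD; [exact: cf|exact: cg].
move=> [df ddf] [dg ddg]; split=> [x Ux|v].
  by apply: differentiableD; [exact: df|exact: dg].
apply: (@Ck_on_eq k U oU (fun x => 'd f x v + 'd g x v)) => [x Ux|].
  by rewrite (@diffD _ _ _ f g) //; [exact: df|exact: dg].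
by apply: IH; [exact: ddf|exact: ddg].
Qed.

Lemma Ck_on_cst (k : nat) (U : set V) (a : W) : open U ->
  Ck_on k U (fun=> a).
Proof.
move=> oU; elim: k a => [|k IH] a /=; first by move=> x _; exact: cvg_cst.
split=> [x _|v]; first exact: differentiable_cst.
by apply: (Ck_on_eq oU (f := fun=> 0)) => // x _; rewrite (@diff_cst _ _ _ a).
Qed.

Lemma Ck_on_sum (k : nat) (U : set V) (m : nat) (f : 'I_m -> V -> W) : open U ->
  (forall i, Ck_on k U (f i)) -> Ck_on k U (fun x => \sum_(i < m) f i x).
Proof.
move=> oU; elim: m f => [|m IH] f Hf.
  by apply: (Ck_on_eq oU (f := fun=> 0)) => [x _|]; [rewrite big_ord0|exact: Ck_on_cst].
apply: (Ck_on_eq oU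
  (f := fun x => f ord0 x + \sum_(i < m) f (lift ord0 i) x)) => [x _|].
  by rewrite big_ord_recl.
by apply: Ck_onD => //; exact: IH.
Qed.

Lemma smooth_on_derive (U : set V) (f : V -> W) (v : V) : open U ->
  smooth_on U f -> smooth_on U ('D_v f).
Proof.
move=> oU sf k; have [df ddf] := sf k.+1.
by apply: (Ck_on_eq oU) (ddf v) => x Ux; rewrite deriveE//; exact: df.
Qed.

Lemma smooth_on_differentiable (U : set V) (f : V -> W) (x : V) :
  smooth_on U f -> U x -> differentiable f x.
Proof. by move=> sf Ux; have [df _] := sf 1%N; exact: df. Qed.

Lemma smooth_on_continuous (U : set V) (f : V -> W) (x : V) :
  smooth_on U f -> U x -> {for x, continuous f}.
Proof. by move=> sf Ux; exact: (sf 0%N). Qed.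

End Germs.

Section Products.
Context {R : realType} {V W : normedModType R}.

Lemma diff_mul (f g : V -> R) (x v : V) :
  differentiable f x -> differentiable g x ->
  'd (fun y => f y * g y) x v = f x * 'd g x v + g x * 'd f x v.
Proof. by move=> df dg; rewrite (diffM df dg). Qed.

Lemma diff_const (a : W) (x v : V) : 'd (fun=> a) x v = 0.
Proof. by rewrite (diff_cst a x). Qed.

Lemma diff_chain (V' : normedModType R) (f : V' -> V) (g : V -> W) (x v : V') :
  differentiable f x -> differentiable g (f x) ->
  'd (fun y => g (f y)) x v = 'd g (f x) ('d f x v).
Proof. by move=> df dg; rewrite (diff_comp df dg). Qed.

Lemma Ck_onM (k : nat) (U : set V) (f g : V -> R) : open U ->
  Ck_on k U f -> Ck_on k U g -> Ck_on k U (fun x => f x * g x).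
Proof.
move=> oU; elim: k f g => [|k IH] f g Hf Hg.
  by move=> x Ux; apply: cvgM; [exact: Hf|exact: Hg].
have [df ddf] := Hf; have [dg ddg] := Hg; split=> [x Ux|v].
  by apply: differentiableM; [exact: df|exact: dg].
apply: (@Ck_on_eq _ _ _ k U oU (fun x => f x * 'd g x v + g x * 'd f x v)).
  by move=> x Ux; rewrite diff_mul //; [exact: df|exact: dg].
apply: Ck_onD => //; apply: IH.
- exact: Ck_onW.
- exact: ddg.
- exact: Ck_onW.
- exact: ddf.
Qed.

Lemma diff_linear_comp (W' : normedModType R) (l : {linear W -> W'})
    (f : V -> W) (x : V) : continuous l -> differentiable f x ->
  differentiable (fun y => l (f y)) x /\
  forall v, 'd (fun y => l (f y)) x v = l ('d f x v).
Proof.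
move=> cl df.
have dl : differentiable l (f x) by exact: linear_differentiable.
split=> [|v]; first exact: (@differentiable_comp _ _ _ _ f l).
by rewrite (@diff_comp _ _ _ _ f l) //= diff_lin.
Qed.

Lemma Ck_on_linear_comp (W' : normedModType R) (k : nat) (U : set V)
    (l : {linear W -> W'}) (f : V -> W) : open U -> continuous l ->
  Ck_on k U f -> Ck_on k U (fun x => l (f x)).
Proof.
move=> oU cl; elim: k f => [|k IH] f.
  by move=> cf x Ux; apply: continuous_comp; [exact: cf|exact: cl].
move=> [df ddf]; split=> [x Ux|v].
  by have [] := diff_linear_comp cl (df x Ux).
apply: (@Ck_on_eq _ _ _ k U oU (fun x => l ('d f x v))) => [x Ux|].
  by have [_ ->] := diff_linear_comp cl (df x Ux).
exact: (IH _ (ddf v)).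
Qed.

(** A map [a] with constant differential leaves the shape of the induction
    unchanged, as no product rule is involved; it is used to freeze one argument
    of the multiplication of the group. *)
Lemma Ck_on_affine_precomp (V' : normedModType R) (k : nat) (U : set V)
    (a : V' -> V) (A : V' -> V) (f : V -> W) : open U ->
  (forall x, differentiable a x) -> (forall x v, 'd a x v = A v) ->
  Ck_on k U f -> Ck_on k (a @^-1` U) (fun x => f (a x)).
Proof.
move=> oU da dA.
have oU' : open (a @^-1` U).
  by apply: open_comp oU => x _; exact: differentiable_continuous.
elim: k f => [|k IH] f.
  move=> cf x Ux; apply: continuous_comp; last exact: cf.
  exact: differentiable_continuous.
move=> [df ddf]; split=> [x Ux|v].
  by apply: differentiable_comp => //; exact: df.
apply: (@Ck_on_eq _ _ _ k _ oU' (fun x => 'd f (a x) (A v))) => [x Ux|].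
  by rewrite (@diff_comp _ _ _ _ a f) //=; [rewrite dA|exact: df].
exact: (IH _ (ddf (A v))).
Qed.

End Products.

(** * Symmetry of second derivatives *)

Section Schwarz.
Context {R : realType} {V : normedModType R}.

Lemma is_derive_line (W : normedModType R) (g : V -> W) (a u : V) (s : R) :
  differentiable g (a + s *: u) ->
  is_derive s 1 (fun s : R => g (a + s *: u)) ('D_u g (a + s *: u)).
Proof.
move=> dg.
have dl : is_diff s (fun s : R => a + s *: u) (fun h : R => h *: u).
  have -> : (fun h : R => h *: u) = (cst 0 + (fun h : R => h *: u)).
    by apply/funext => h /=; rewrite /= !fctE add0r.
  exact: is_diffD.
have dgl : differentiable (g \o (fun s : R => a + s *: u)) s.
  by apply: differentiable_comp => //; exact: ex_diff.
apply: DeriveDef; first exact: diff_derivable.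
rewrite (@deriveE _ _ _ (g \o (fun s : R => a + s *: u))) //.
rewrite (diff_comp (@ex_diff _ _ _ _ _ _ _ dl) dg) /=.
by rewrite deriveE // diff_val scale1r.
Qed.

Lemma mean_value_line (g : V -> R) (a u : V) (h : R) : 0 < h ->
  (forall s : R, 0 <= s <= h -> differentiable g (a + s *: u)) ->
  exists2 c : R, 0 <= c <= h & g (a + h *: u) - g a = 'D_u g (a + c *: u) * h.
Proof.
move=> h0 dg.
have H (s : R) : s \in `[0, h]%R -> is_derive s 1 (fun s : R => g (a + s *: u))
    ('D_u g (a + s *: u)).
  by rewrite in_itv /= => sh; apply: is_derive_line; exact: dg.
have cg : {within `[0, h], continuous (fun s : R => g (a + s *: u))}.
  by apply: derivable_within_continuous => s /H[].
have H' (s : R) : s \in `]0, h[%R -> is_derive s 1 (fun s : R => g (a + s *: u))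
    ('D_u g (a + s *: u)).
  by move=> sh; apply: H; exact: subset_itv_oo_cc.
have [c ch] := MVT h0 H' cg.
rewrite scale0r addr0 subr0 => ->; exists c => //.
by have := subset_itv_oo_cc ch; rewrite in_itv.
Qed.

(** The mean value theorem is used twice: in the direction [u] for
    [y |-> f (y + h *: v) - f y], then in the direction [v] for ['D_u f]. *)
Lemma second_difference (U : set V) (f : V -> R) (x u v : V) (h : R) :
  open U -> smooth_on U f -> 0 < h ->
  (forall s t : R, 0 <= s <= h -> 0 <= t <= h -> U (x + s *: u + t *: v)) ->
  exists s t : R, [/\ 0 <= s <= h, 0 <= t <= h &
    f (x + h *: u + h *: v) - f (x + h *: u) - f (x + h *: v) + f x =
    'D_v ('D_u f) (x + s *: u + t *: v) * h * h].
Proof.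
move=> oU sf h0 HU.
pose g (y : V) := f (y + h *: v) - f y.
have hh : 0 <= h <= h by rewrite lexx ltW.
have h00 : 0 <= (0 : R) <= h by rewrite lexx ltW.
have dfx (s t : R) : 0 <= s <= h -> 0 <= t <= h ->
    differentiable f (x + s *: u + t *: v).
  by move=> sh th; apply: smooth_on_differentiable sf _; exact: HU.
have dfx0 (s : R) : 0 <= s <= h -> differentiable f (x + s *: u).
  by move=> sh; have := dfx s 0 sh h00; rewrite scale0r addr0.
have shd (y : V) : is_diff y (fun y => y + h *: v) (fun w => w).
  have -> : (fun w : V => w) = (id + cst 0).
    by apply/funext => w /=; rewrite !fctE addr0.
  exact: is_diffD.
have dfsh (s : R) : 0 <= s <= h -> differentiable (f \o (fun y => y + h *: v)) (x + s *: u).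
  by move=> sh; apply: differentiable_comp; [exact: ex_diff|exact: dfx].
have dg (s : R) : 0 <= s <= h -> differentiable g (x + s *: u).
  by move=> sh; apply: differentiableB; [exact: dfsh|exact: dfx0].
have [s sh Hs] := mean_value_line h0 dg.
have sf' := smooth_on_derive u oU sf.
have [|t th Ht] := @mean_value_line ('D_u f) (x + s *: u) v h h0.
  by move=> t th; apply: smooth_on_differentiable sf' _; exact: HU.
exists s, t; split => //.
rewrite -Ht; transitivity (g (x + h *: u) - g x).
  by rewrite /g; ring.
rewrite Hs; congr (_ * _).
rewrite deriveE; last exact: dg.
rewrite (@diffB _ _ _ (f \o (fun y => y + h *: v)) f); [|exact: dfsh|exact: dfx0].
rewrite /= !fctE (@diff_comp _ _ _ _ (fun y => y + h *: v) f) /=; last 2 first.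
- exact: ex_diff.
- exact: dfx.
by rewrite diff_val !deriveE //; [exact: dfx0|exact: dfx].
Qed.

Lemma dist_le_halves (p q r e : R) :
  `|p - r| <= e / 2 -> `|q - r| <= e / 2 -> `|q - p| <= e.
Proof.
move=> A B; have -> : q - p = (q - r) - (p - r) by ring.
by apply: le_trans (ler_normB _ _) _; rewrite [leRHS](splitr e) lerD.
Qed.

Lemma near_dist_le2 (U : set V) (p q : V -> R) (x : V) (e : R) :
  open U -> U x -> {for x, continuous p} -> {for x, continuous q} -> 0 < e ->
  \forall y \near x, [/\ U y, `|p x - p y| <= e & `|q x - q y| <= e].
Proof.
move=> oU Ux cp cq e0.
have n1 : \forall y \near x, U y by exact: open_nbhs_nbhs.
by apply: filterS3 n1 (near_dist_le cp e0) (near_dist_le cq e0) => y; split.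
Qed.

(** The second difference is symmetric in [u] and [v], so both mixed derivatives
    take a common value arbitrarily close to [x]; they are continuous at [x]. *)
Lemma schwarz_real (U : set V) (f : V -> R) (x u v : V) : open U ->
  smooth_on U f -> U x -> 'D_u ('D_v f) x = 'D_v ('D_u f) x.
Proof.
move=> oU sf Ux; apply/eqP; rewrite -subr_eq0 -normr_eq0.
rewrite eq_le normr_ge0 andbT; apply/ler_addgt0Pl => /= e e0; rewrite addr0.
have e20 : 0 < e / 2 by rewrite divr_gt0.
have suv := smooth_on_continuous
  (smooth_on_derive v oU (smooth_on_derive u oU sf)) Ux.
have svu := smooth_on_continuous
  (smooth_on_derive u oU (smooth_on_derive v oU sf)) Ux.
have near_x := near_dist_le2 oU Ux suv svu e20.
have /nbhs_normP[d /= d0 Hd] := near_x.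
(* Adding 1 keeps the bound positive when [u] and [v] vanish. *)
pose M := `|u| + `|v| + 1.
have M0 : 0 < M by rewrite ltr_wpDl // addr_ge0.
pose h := d / 2 / M.
have h0 : 0 < h by rewrite !divr_gt0.
have Hh (s t : R) : 0 <= s <= h -> 0 <= t <= h ->
    ball_ Num.norm x d (x + s *: u + t *: v).
  move=> /andP[s0 sh] /andP[t0 th]; rewrite /ball_ /=.
  rewrite -addrA opprD addrA subrr add0r normrN.
  apply: le_lt_trans (ler_normD _ _) _; rewrite !normrZ !ger0_norm //.
  have hd : h * M = d / 2 by rewrite /h divfK // gt_eqF.
  have : s * `|u| + t * `|v| <= h * M.
    by rewrite /M !mulrDr mulr1 -[leLHS]addr0 !lerD // ?ler_wpM2r // ltW.
  move=> /le_lt_trans; apply; rewrite hd.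
  by rewrite ltr_pdivrMr // ltr_pMr // ltr1n.
have [s [t [sh th E]]] := @second_difference U f x u v h oU sf h0
  (fun s t sh th => let: And3 a _ _ := Hd _ (Hh s t sh th) in a).
have Hh' (s' t' : R) : 0 <= s' <= h -> 0 <= t' <= h ->
    ball_ Num.norm x d (x + s' *: v + t' *: u).
  by move=> sh' th'; rewrite addrAC; exact: Hh.
have [t' [s' [th' sh' E']]] := @second_difference U f x v u h oU sf h0
  (fun s t sh th => let: And3 a _ _ := Hd _ (Hh' s t sh th) in a).
have EE : 'D_v ('D_u f) (x + s *: u + t *: v) = 'D_u ('D_v f) (x + t' *: v + s' *: u).
  have hn0 : h != 0 by rewrite gt_eqF.
  apply: (mulIf hn0); apply: (mulIf hn0).
  apply: etrans (esym E) _; apply: etrans _ E'.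
  by rewrite [x + h *: v + _]addrAC; congr (_ + _); exact: addrAC.
have [_ A _] := Hd _ (Hh _ _ sh th).
have [_ _ B] := Hd _ (Hh' _ _ th' sh').
by rewrite EE in A; exact: dist_le_halves A B.
Qed.

End Schwarz.

(** * Differential calculus in coordinates *)

Section Coordinates.
Context {R : realType} {n : nat}.

Definition row_coord (j : 'I_n) (v : 'rV[R]_n) : R := v 0 j.

Fact row_coord_is_linear j : linear (row_coord j).
Proof. by move=> a u v; rewrite /row_coord !mxE. Qed.

HB.instance Definition _ j :=
  GRing.isLinear.Build R 'rV[R]_n R *%R (row_coord j) (row_coord_is_linear j).

Lemma row_coord_continuous j : continuous (row_coord j).
Proof. exact: coord_continuous. Qed.

(** Named, like [row_coord], so that it carries a linear structure: the two
    maps split a vector into coordinates and reassemble it. *)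
Definition scale_vec (W : normedModType R) (w : W) (r : R) : W := r *: w.

Fact scale_vec_is_linear (W : normedModType R) (w : W) : linear (scale_vec w).
Proof. by move=> a r s; rewrite /scale_vec scalerDl scalerA. Qed.

HB.instance Definition _ (W : normedModType R) (w : W) :=
  GRing.isLinear.Build R R W *:%R (scale_vec w) (scale_vec_is_linear w).

Lemma scale_vec_continuous (W : normedModType R) (w : W) :
  continuous (scale_vec w).
Proof. by move=> r; exact: scalel_continuous. Qed.

End Coordinates.

Section RowValued.
Context {R : realType} {n : nat} {V : normedModType R}.

Lemma diff_coord (f : V -> 'rV[R]_n) (x : V) (j : 'I_n) : differentiable f x ->
  differentiable (fun y => f y 0 j) x /\
  forall v, 'd (fun y => f y 0 j) x v = ('d f x v) 0 j.
Proof.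
move=> df; exact: (diff_linear_comp (@row_coord_continuous R n j) df).
Qed.

Lemma Ck_on_coord (k : nat) (U : set V) (f : V -> 'rV[R]_n) (j : 'I_n) :
  open U -> Ck_on k U f -> Ck_on k U (fun x => f x 0 j).
Proof.
move=> oU; exact: (Ck_on_linear_comp oU (@row_coord_continuous R n j)).
Qed.

Lemma row_sum_scale_vec (v : 'rV[R]_n) :
  v = \sum_(j < n) scale_vec (delta_mx 0 j : 'rV[R]_n) (v 0 j).
Proof. exact: row_sum_delta. Qed.

Lemma Ck_on_row (k : nat) (U : set V) (f : V -> 'rV[R]_n) : open U ->
  (forall j, Ck_on k U (fun x => f x 0 j)) -> Ck_on k U f.
Proof.
move=> oU Hf; pose g j x := scale_vec (delta_mx 0 j : 'rV[R]_n) (f x 0 j).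
apply: (@Ck_on_eq _ _ _ k U oU (fun x => \sum_(j < n) g j x)) => [x _|].
  by rewrite [RHS]row_sum_scale_vec.
apply: Ck_on_sum => // j.
exact: (Ck_on_linear_comp oU (@scale_vec_continuous _ _ _) (Hf j)).
Qed.

End RowValued.

Section DiffAlong.
Context {R : realType} {n : nat} {V : normedModType R}.

Lemma diff_linear_expand (l : {linear 'rV[R]_n -> V}) (W : normedModType R)
    (f : V -> W) (z : V) (v : 'rV[R]_n) : differentiable f z ->
  'd f z (l v) = \sum_(j < n) v 0 j *: 'D_(l (delta_mx 0 j)) f z.
Proof.
move=> df; rewrite {1}(row_sum_delta v) !linear_sum; apply: eq_bigr => j _.
by rewrite !linearZ deriveE.
Qed.

Lemma is_diff_bigsum (W : normedModType R) (m : nat) (f : 'I_m -> V -> W)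
    (z h : V) : (forall j, differentiable (f j) z) ->
  differentiable (fun z => \sum_(j < m) f j z) z /\
  'd (fun z => \sum_(j < m) f j z) z h = \sum_(j < m) 'd (f j) z h.
Proof.
move=> df; have -> : (fun z => \sum_(j < m) f j z) = \sum_(j < m) f j.
  by apply/funext => y; rewrite fct_sumE.
have ds : differentiable (\sum_(j < m) f j) z by exact: differentiable_sum.
split=> //; rewrite -deriveE // derive_sum => [|j]; last exact: diff_derivable.
by apply: eq_bigr => j _; rewrite deriveE.
Qed.

Lemma diff_derive_expand (U : set V) (f : V -> R) (l : {linear 'rV[R]_n -> V})
    (z h : V) (v : 'rV[R]_n) : open U -> smooth_on U f -> U z ->
  'd ('D_(l v) f) z h = \sum_(j < n) v 0 j * 'd ('D_(l (delta_mx 0 j)) f) z h.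
Proof.
move=> oU sf Uz.
pose q j p := v 0 j * 'D_(l (delta_mx 0 j)) f p.
have dD j : differentiable ('D_(l (delta_mx 0 j)) f) z.
  exact: smooth_on_differentiable (smooth_on_derive _ oU sf) Uz.
have dq j : differentiable (q j) z.
  by apply: differentiableM => //; exact: differentiable_cst.
have [dsq Esq] := is_diff_bigsum h dq.
have nq : \forall p \near z, \sum_(j < n) q j p = 'D_(l v) f p.
  apply: (open_eq_near oU) => // p Up; have dfp := smooth_on_differentiable sf Up.
  by rewrite deriveE // diff_linear_expand.
have [_ Eq] := near_eq_diff nq dsq; apply: etrans (congr1 (@^~ h) Eq) _.
rewrite Esq; apply: eq_bigr => j _.
apply: etrans (diff_mul _ (differentiable_cst _ _) (dD j)) _.
by rewrite diff_const mulr0 addr0.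
Qed.

End DiffAlong.

Section DiffAlongMap.
Context {R : realType} {n : nat} {V S : normedModType R}.

(** Product rule for the pairing of the differential at a moving point with a
    moving vector.  The map [l] places the vector in a subspace of [V], such as
    the fibre directions in a product. *)
Lemma diff_along (U : set V) (f : V -> R)
    (l : {linear 'rV[R]_n -> V}) (z : S -> V) (w : S -> 'rV[R]_n) (s h : S) :
  open U -> smooth_on U f -> U (z s) ->
  differentiable z s -> differentiable w s ->
  differentiable (fun s => 'd f (z s) (l (w s))) s /\
  'd (fun s => 'd f (z s) (l (w s))) s h =
    'd ('D_(l (w s)) f) (z s) ('d z s h) + 'd f (z s) (l ('d w s h)).
Proof.
move=> oU sf Uz dz dw.
pose e j : 'rV[R]_n := delta_mx 0 j.
have dD j : differentiable ('D_(l (e j)) f) (z s).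
  exact: smooth_on_differentiable (smooth_on_derive _ oU sf) Uz.
pose g j s := w s 0 j * 'D_(l (e j)) f (z s).
have ng : \forall s \near s, \sum_(j < n) g j s = 'd f (z s) (l (w s)).
  have : \forall s' \near s, U (z s').
    apply: (differentiable_continuous dz); exact: open_nbhs_nbhs.
  apply: filterS => s' Us'; have df := smooth_on_differentiable sf Us'.
  by rewrite diff_linear_expand.
have dwj j := diff_coord j dw.
have dDz j : differentiable (fun s => 'D_(l (e j)) f (z s)) s.
  exact: (differentiable_comp dz (dD j)).
have dgj j : differentiable (g j) s.
  by apply: differentiableM => //; have [] := dwj j.
have [dg Eg] := is_diff_bigsum h dgj.
have [d1 E1] := near_eq_diff ng dg; split=> //.
apply: etrans (congr1 (@^~ h) E1) _; rewrite Eg.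
rewrite (diff_derive_expand _ _ _ oU sf Uz).
rewrite (diff_linear_expand _ _ (smooth_on_differentiable sf Uz)).
rewrite -big_split /=; apply: eq_bigr => j _.
have [dwj1 dwj2] := dwj j.
apply: etrans (diff_mul _ dwj1 (dDz j)) _.
rewrite dwj2 (diff_chain _ dz (dD j)); congr (_ + _); exact: mulrC.
Qed.

End DiffAlongMap.

(** The Lie derivative of a function along a vector field; along an integral
    curve it is the time derivative, whence the smoothness of that curve. *)
Lemma smooth_on_lie_derivative {R : realType} {n : nat} (U : set 'rV[R]_n)
    (f : 'rV[R]_n -> R) (w : 'rV[R]_n -> 'rV[R]_n) :
  open U -> smooth_on U f -> smooth_on U w ->
  smooth_on U (fun p => 'd f p (w p)).
Proof.
move=> oU sf sw k.
apply: (@Ck_on_eq _ _ _ k U oU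
  (fun p => \sum_(j < n) w p 0 j * 'D_(delta_mx 0 j) f p)) => [p Up|].
  rewrite [in RHS](row_sum_delta (w p)) linear_sum; apply: eq_bigr => j _.
  by rewrite linearZ deriveE //; exact: smooth_on_differentiable sf Up.
apply: Ck_on_sum => // j; apply: Ck_onM => //.
  by apply: Ck_on_coord => //; exact: sw.
exact: (smooth_on_derive _ oU sf).
Qed.

Lemma smooth_row_coord {R : realType} {n : nat} (j : 'I_n) (U : set 'rV[R]_n) :
  open U -> smooth_on U (row_coord j).
Proof.
move=> oU; have dj (p : 'rV[R]_n) : differentiable (row_coord j) p.
  by apply: linear_differentiable; exact: row_coord_continuous.
case=> [|k]; first by move=> p _; exact: row_coord_continuous.
split=> [p _|v]; first exact: dj.
apply: (Ck_on_eq oU (f := fun=> row_coord j v)) => [p _|]; last exact: Ck_on_cst.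
by rewrite diff_lin //; exact: row_coord_continuous.
Qed.

Section Homogeneity.
Context {R : realType} {V : normedModType R}.

(** Euler's identity: differentiate [s |-> g (z + s *: v)] at 0. *)
Lemma derive_homogeneous (g : V -> R) (z v : V) (m : nat) :
  differentiable g z ->
  (\forall s \near (0 : R), g (z + s *: v) = (1 + s) ^+ m * g z) ->
  'd g z v = m%:R * g z.
Proof.
move=> dg Hg.
have dg0 : differentiable g (z + 0 *: v) by rewrite scale0r addr0.
have := is_derive_line dg0; rewrite scale0r addr0 => H.
have H2 : is_derive (0 : R) 1 (fun s : R => (1 + s) ^+ m * g z) (m%:R * g z).
  have d1 : is_derive (0 : R) 1 (fun s : R => 1 + s) (0 + 1).
    exact: is_deriveD (is_derive_cst _ _ _) (is_derive_id _ _).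
  have dm : is_derive (0 : R) 1 (fun s : R => (1 + s) ^+ m)
      (m%:R * (1 + 0) ^+ m.-1 * (0 + 1)).
    have -> : (fun s : R => (1 + s) ^+ m) = (fun s : R => 1 + s) ^+ m.
      by apply/funext => s; rewrite exprfctE.
    exact: (is_deriveX m d1).
  have dc : is_derive (0 : R) 1 (fun=> g z : R) 0 by exact: is_derive_cst.
  apply: is_derive_eq (is_deriveM dm dc) _.
  by rewrite scaler0 !addr0 expr1n !add0r !mulr1; exact: mulrC.
have [_ E1] := H; have [_ E2] := H2.
rewrite -deriveE // -E1 -E2; exact: near_eq_derive.
Qed.

End Homogeneity.

Section Reparametrization.
Context {R : realType}.

Lemma is_derive_affine (W : normedModType R) (y : R -> W) (dy : W) (a c t : R) :
  is_derive (a + t * c) 1 y dy ->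
  is_derive t 1 (fun t : R => y (a + t * c)) (c *: dy).
Proof.
move=> [yd <-].
have yd' : differentiable y (a + t *: c) by apply/derivable1_diffP.
apply: is_derive_eq (is_derive_line yd') _.
by rewrite !deriveE // -[X in 'd y _ X]mulr1 -[c * 1]/(c *: 1) linearZ.
Qed.

End Reparametrization.

Lemma is_derive_chain {R : realType} {V W : normedModType R} (x : R -> V)
    (f : V -> W) (t : R) (v : V) : is_derive t 1 x v -> differentiable f (x t) ->
  is_derive t 1 (fun s => f (x s)) ('d f (x t) v).
Proof.
move=> [dx <-] df.
have dx' : differentiable x t by apply/derivable1_diffP.
have dfx := differentiable_comp dx' df.
apply: DeriveDef; first exact: diff_derivable.
apply: etrans (deriveE _ dfx) _; rewrite deriveE //.
exact: diff_chain.
Qed.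

Lemma diff_left_inverse {R : realType} {V W : normedModType R} (f : V -> W)
    (h : W -> V) (x v : V) : differentiable f x -> differentiable h (f x) ->
  (\forall y \near x, h (f y) = y) -> 'd f x v = 0 -> v = 0.
Proof.
move=> df dh hf f0.
have hf' : \forall y \near x, h (f y) = idfun y by [].
have [_ E] := near_eq_diff hf' (differentiable_comp df dh).
have := congr1 (@^~ v) E; rewrite diff_chain // f0 linear0 => <-.
by rewrite (@diff_val _ _ _ _ _ _ _ (is_diff_id x)).
Qed.

Lemma diff_graph {R : realType} {V W : normedModType R} (f : V -> W) (x : V) :
  differentiable f x -> differentiable (fun y => (y, f y)) x /\
  forall v, 'd (fun y => (y, f y)) x v = (v, 'd f x v).
Proof.
move=> df; have did := @ex_diff _ _ _ _ _ _ _ (is_diff_id x).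
split=> [|v]; first exact: (differentiable_pair did df).
apply: etrans (congr1 (@^~ v) (diff_pair did df)) _ => /=.
by congr pair; rewrite (@diff_val _ _ _ _ _ _ _ (is_diff_id x)).
Qed.

Section Pairs.
Context {R : realType}.

Lemma is_diff_pairr (V W : normedModType R) (p : V) (q : W) :
  is_diff q (fun q => (p, q)) (fun v => (0, v)).
Proof. exact: (is_diff_pair (is_diff_cst p q) (is_diff_id q)). Qed.

Lemma is_diff_pairl (V W : normedModType R) (p : V) (q : W) :
  is_diff p (fun p => (p, q)) (fun v => (v, 0)).
Proof. exact: (is_diff_pair (is_diff_id p) (is_diff_cst q p)). Qed.

End Pairs.

Section PairInjections.
Context {R : realType} {n : nat}.

Definition inl_row (v : 'rV[R]_n) : 'rV[R]_n * 'rV[R]_n := (v, 0).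
Definition inr_row (v : 'rV[R]_n) : 'rV[R]_n * 'rV[R]_n := (0, v).

Fact inl_row_is_linear : linear inl_row.
Proof. by move=> a u v; rewrite /inl_row; congr pair; rewrite /= scaler0 addr0. Qed.

Fact inr_row_is_linear : linear inr_row.
Proof. by move=> a u v; rewrite /inr_row; congr pair; rewrite /= scaler0 addr0. Qed.

HB.instance Definition _ := GRing.isLinear.Build R 'rV[R]_n
  ('rV[R]_n * 'rV[R]_n)%type *:%R inl_row inl_row_is_linear.
HB.instance Definition _ := GRing.isLinear.Build R 'rV[R]_n
  ('rV[R]_n * 'rV[R]_n)%type *:%R inr_row inr_row_is_linear.

Lemma pair_inl_inr (u v : 'rV[R]_n) : (u, v) = inl_row u + inr_row v.
Proof. by rewrite /inl_row /inr_row; congr pair; rewrite /= ?addr0 ?add0r. Qed.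

Lemma differentiable_snd_coord (j : 'I_n) (p : 'rV[R]_n * 'rV[R]_n) :
  differentiable (fun q : 'rV[R]_n * 'rV[R]_n => q.2 0 j) p /\
  forall v, 'd (fun q : 'rV[R]_n * 'rV[R]_n => q.2 0 j) p v = v.2 0 j.
Proof.
have c2 : continuous (snd : 'rV[R]_n * 'rV[R]_n -> 'rV[R]_n).
  by move=> z; exact: cvg_snd.
have d2 : differentiable (snd : 'rV[R]_n * 'rV[R]_n -> 'rV[R]_n) p.
  exact: linear_differentiable.
have [dj Ej] := diff_coord j d2; split=> // v.
by rewrite Ej diff_lin.
Qed.

End PairInjections.

Section RelatedFields.
Context {R : realType} {n : nat}.
Implicit Types (phi V W : 'rV[R]_n -> 'rV[R]_n) (U : set 'rV[R]_n).

(** Differentiate the relation [W (phi q) = 'd phi q (V q)]; only the first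
    term on the right involves second derivatives of [phi]. *)
Lemma diff_related_field U phi V W (q h : 'rV[R]_n) (i : 'I_n) :
  open U -> smooth_on U phi -> U q ->
  (forall q, U q -> W (phi q) = 'd phi q (V q)) ->
  differentiable V q -> differentiable W (phi q) ->
  ('d W (phi q) ('d phi q h)) 0 i =
  'D_h ('D_(V q) (fun q => phi q 0 i)) q + ('d phi q ('d V q h)) 0 i.
Proof.
move=> oU sphi Uq WV dV dW.
pose f q := phi q 0 i.
have sf : smooth_on U f by move=> k; apply: Ck_on_coord => //; exact: sphi.
have dphi q' : U q' -> differentiable phi q' by exact: smooth_on_differentiable.
have df q' v : U q' -> 'd f q' v = ('d phi q' v) 0 i.
  by move=> /dphi dp; have [_ ->] := diff_coord i dp.
have did := @ex_diff _ _ _ _ _ _ _ (is_diff_id q).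
have [_ A] := @diff_along _ _ _ _ U f idfun idfun V q h oU sf Uq did dV.
have dcomp : differentiable (fun q => W (phi q)) q.
  exact: differentiable_comp (dphi q Uq) dW.
have [dci Eci] := diff_coord i dcomp.
have nE : \forall q \near q, W (phi q) 0 i = 'd f (idfun q) (idfun (V q)).
  apply: (open_eq_near oU) Uq => q' Uq'.
  apply: etrans _ (esym (df q' _ Uq')).
  exact: (congr1 (fun v : 'rV[R]_n => v 0 i) (WV q' Uq')).
have [_ B] := near_eq_diff nE dci.
have C := diff_chain h (dphi q Uq) dW.
apply: etrans (congr1 (fun v : 'rV[R]_n => v 0 i) (esym C)) _.
apply: etrans (esym (Eci h)) _.
apply: etrans (esym (congr1 (@^~ h) B)) _; apply: etrans A _.
rewrite df //; congr (_ + _).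
have -> : 'd idfun q h = h by rewrite (@diff_val _ _ _ _ _ _ _ (is_diff_id q)).
rewrite -deriveE //; apply: smooth_on_differentiable Uq.
exact: smooth_on_derive.
Qed.

(** The second derivatives of [phi] cancel by symmetry, so the bracket is
    natural under maps that are merely smooth. *)
Lemma related_bracket U phi V1 V2 W1 W2 (q : 'rV[R]_n) :
  open U -> smooth_on U phi -> U q ->
  (forall q, U q -> W1 (phi q) = 'd phi q (V1 q)) ->
  (forall q, U q -> W2 (phi q) = 'd phi q (V2 q)) ->
  differentiable V1 q -> differentiable V2 q ->
  differentiable W1 (phi q) -> differentiable W2 (phi q) ->
  'd W2 (phi q) (W1 (phi q)) - 'd W1 (phi q) (W2 (phi q)) =
  'd phi q ('d V2 q (V1 q) - 'd V1 q (V2 q)).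
Proof.
move=> oU sphi Uq WV1 WV2 dV1 dV2 dW1 dW2; apply/rowP => i.
have sf : smooth_on U (fun q => phi q 0 i).
  by move=> k; apply: Ck_on_coord => //; exact: sphi.
have E1 := diff_related_field (V1 q) i oU sphi Uq WV2 dV2 dW2.
have E2 := diff_related_field (V2 q) i oU sphi Uq WV1 dV1 dW1.
have S := schwarz_real (V1 q) (V2 q) oU sf Uq.
have coordB (u v : 'rV[R]_n) : (u - v) 0 i = u 0 i - v 0 i by rewrite !mxE.
have addKB (t a b : R) : (t + a) - (t + b) = a - b by ring.
have F1 := etrans (congr1 (fun v : 'rV[R]_n => ('d W2 (phi q) v) 0 i) (WV1 q Uq))
  (etrans E1 (congr1 (+%R^~ _) S)).
have F2 := etrans (congr1 (fun v : 'rV[R]_n => ('d W1 (phi q) v) 0 i) (WV2 q Uq)) E2.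
apply: etrans (coordB _ _) _.
apply: etrans (congr2 (fun a b : R => a - b) F1 F2) _.
apply: etrans (addKB _ _ _) _.
apply: etrans (esym (coordB _ _)) _.
exact: (congr1 (fun v : 'rV[R]_n => v 0 i) (esym (linearB _ _ _))).
Qed.

End RelatedFields.

(** * Ordinary differential equations *)

Section SequencesAndNorms.
Context {R : realType}.

Lemma row_norm_leP (n : nat) (v : 'rV[R]_n) (e : R) : 0 <= e ->
  (forall j, `|v 0 j| <= e) <-> `|v| <= e.
Proof.
move=> e0; rewrite {2}/Num.norm /= mx_normrE; split=> [H|H j].
  by apply: bigmax_le => // -[i j] _ /=; rewrite ord1.
by apply: le_trans H; exact: (le_bigmax _ (fun ij : 'I_1 * 'I_n => `|v ij.1 ij.2|) (0, j)).
Qed.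

Lemma norm_coord_le (n : nat) (v : 'rV[R]_n) j : `|v 0 j| <= `|v|.
Proof. by apply: (row_norm_leP v (normr_ge0 v)).2. Qed.

Lemma norm_coordB_le (n : nat) (v w : 'rV[R]_n) j : `|v 0 j - w 0 j| <= `|v - w|.
Proof. by have := norm_coord_le (v - w) j; rewrite !mxE. Qed.

(** The intervals of centre [u k] and radius [2 * C * 2^-1 ^+ k] are nested;
    the supremum of their left ends lies in all of them. *)
Lemma geometric_cauchy_limit (u : nat -> R) (C : R) :
  (forall k, `|u k.+1 - u k| <= C * 2^-1 ^+ k) ->
  exists l, forall k, `|u k - l| <= 2 * C * 2^-1 ^+ k.
Proof.
move=> Hu.
pose r k : R := 2 * C * 2^-1 ^+ k.
have C0 : 0 <= C by have := Hu 0%N; rewrite expr0 mulr1; apply: le_trans.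
have r0 k : 0 <= r k by rewrite /r !mulr_ge0 ?exprn_ge0.
have rS k : r k - r k.+1 = C * 2^-1 ^+ k by rewrite /r exprS; field.
have aS k m : (k <= m)%N -> u k - r k <= u m - r m.
  move=> /subnK <-; elim: (m - k)%N => // i; move=> /le_trans; apply.
  rewrite addSn; have := Hu (i + k)%N; rewrite -rS ler_norml => /andP[H _].
  by lra.
have bS k m : (k <= m)%N -> u m + r m <= u k + r k.
  move=> /subnK <-; elim: (m - k)%N => // i; apply: le_trans.
  rewrite addSn; have := Hu (i + k)%N; rewrite -rS ler_norml => /andP[_ H].
  by lra.
have ab k m : u k - r k <= u m + r m.
  have [km|/ltnW mk] := leqP k m.
    by apply: le_trans (aS _ _ km) _; have := r0 m; lra.
  by apply: le_trans _ (bS _ _ mk); have := r0 k; lra.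
pose E := range (fun k => u k - r k).
have E0 : E !=set0 by exists (u 0%N - r 0%N); exists 0%N.
have Eub m : ubound E (u m + r m) by move=> _ [k _ <-]; exact: ab.
exists (sup E) => k; rewrite ler_norml.
have : u k - r k <= sup E.
  by apply: sup_upper_bound; [split=> //; exists (u 0%N + r 0%N); exact: Eub|exists k].
have := ge_sup E0 (Eub k); rewrite -/(r k); lra.
Qed.

Lemma lipschitz_continuous (V W : normedModType R) (f : V -> W) (K : R) :
  (forall s t, `|f s - f t| <= K * `|s - t|) -> continuous f.
Proof.
move=> Hf t; apply/cvgrPdist_le => e e0.
have K0 : 0 < `|K| + 1 by rewrite ltr_wpDl.
near=> s; apply: le_trans (Hf _ _) _.
apply: (@le_trans _ _ ((`|K| + 1) * `|t - s|)).
  by rewrite ler_wpM2r // (le_trans (ler_norm K)) // lerDl.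
rewrite mulrC -ler_pdivlMr //; near: s.
by apply: (@cvgr_dist_le _ _ _ _ _ id t); [exact: cvg_id|rewrite divr_gt0].
Unshelve. all: by end_near. Qed.

(** This bound replaces every estimate on integrals in the iteration below. *)
Lemma lipschitz_of_derive (f df : R -> R) (a b e : R) :
  (forall t, a <= t <= b -> is_derive t 1 f (df t)) ->
  (forall t, a <= t <= b -> `|df t| <= e) ->
  forall s t, a <= s <= b -> a <= t <= b -> `|f s - f t| <= e * `|s - t|.
Proof.
move=> Hf He.
have H s t : a <= s -> t <= b -> s < t -> `|f s - f t| <= e * `|s - t|.
  move=> sa tb st.
  have Hi x : x \in `[s, t]%R -> is_derive x 1 f (df x).
    rewrite in_itv /= => /andP[sx xt]; apply: Hf.
    by rewrite (le_trans sa sx) (le_trans xt tb).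
  have cf : {within `[s, t], continuous f}.
    by apply: derivable_within_continuous => x /Hi[].
  have Ho x : x \in `]s, t[%R -> is_derive x 1 f (df x).
    by move=> xi; apply: Hi; exact: subset_itv_oo_cc.
  have [c /andP[/ltW sc /ltW ct] E] := MVT st Ho cf.
  rewrite distrC E normrM (distrC s) ler_wpM2r //; apply: He.
  by rewrite (le_trans sa sc) (le_trans ct tb).
move=> s t /andP[sa sb] /andP[ta tb].
have [st|ts|->] := ltgtP s t; first exact: H.
  by rewrite distrC (distrC s); exact: H.
by rewrite !subrr normr0 mulr0.
Qed.

End SequencesAndNorms.

Section Antiderivative.
Context {R : realType}.

(** Integrating from -2 makes every point of ]-2, 2[ interior to the domain of
    integration, on both sides of the base point 0. *)
Definition antiderivative (f : R -> R) (t : R) : R :=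
  parameterized_integral lebesgue_measure (- 2) t f
  - parameterized_integral lebesgue_measure (- 2) 0 f.

Lemma antiderivative0 f : antiderivative f 0 = 0.
Proof. exact: subrr. Qed.

Lemma is_derive_antiderivative (f : R -> R) (t : R) : continuous f ->
  -2 < t < 2 -> is_derive t 1 (antiderivative f) (f t).
Proof.
move=> cf /andP[t1 t2].
have intf : lebesgue_measure.-integrable `[- 2, 2] (EFin \o f).
  apply: continuous_compact_integrable; first exact: segment_compact.
  exact: continuous_subspaceT.
have [dF EF] := continuous_FTC1_closed t2 intf t1 (cf t).
(* Only the first term of [antiderivative] varies with the upper bound. *)
pose P x := parameterized_integral lebesgue_measure (- 2) x f.
have dP : is_derive t 1 P (f t).
  by apply: DeriveDef; [exact: dF|rewrite -derive1E; exact: EF].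
apply: is_derive_eq (is_deriveB dP (is_derive_cst (P 0) t 1)) _.
exact: subr0.
Qed.

End Antiderivative.

Section Clamp.
Context {R : realType}.

Definition clamp (a b t : R) : R := Num.max a (Num.min b t).

Lemma clamp_itv (a b t : R) : a <= b -> a <= clamp a b t <= b.
Proof.
by move=> ab; rewrite /clamp le_max lexx /= ge_max ab ge_min lexx.
Qed.

Lemma clamp_id (a b t : R) : a <= t <= b -> clamp a b t = t.
Proof. by move=> /andP[at' tb]; rewrite /clamp min_r // max_r. Qed.

Lemma clamp_lipschitz (a b s t : R) : `|clamp a b s - clamp a b t| <= `|s - t|.
Proof.
rewrite /clamp.
wlog st : s t / s <= t.
  by move=> H; have [/H//|/ltW/H] := leP s t; rewrite distrC (distrC t).
rewrite (distrC s) (ger0_norm (_ : 0 <= t - s)) ?subr_ge0 //.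
have m1 : Num.min b s <= Num.min b t.
  by rewrite le_min !ge_min lexx /= st orbT.
have m2 : Num.max a (Num.min b s) <= Num.max a (Num.min b t).
  by rewrite ge_max !le_max lexx /= m1 orbT.
rewrite distrC ger0_norm ?subr_ge0 // lerBlDr.
rewrite ge_max; apply/andP; split.
  apply: (le_trans (_ : a <= Num.max a (Num.min b s))); first by rewrite le_max lexx.
  by rewrite lerDr subr_ge0.
apply: (@le_trans _ _ (t - s + Num.min b s)); last by rewrite lerD2l le_max lexx orbT.
have [bs|sb] := leP b s; first by rewrite ge_min; apply/orP; left; rewrite lerDr subr_ge0.
by rewrite subrK ge_min lexx orbT.
Qed.

End Clamp.

Section Picard.
Context {R : realType} {n : nat}.
Variables (V : 'rV[R]_n -> 'rV[R]_n) (B : R) (p0 : 'rV[R]_n).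
Hypothesis V_bounded : forall p, `|V p| <= B.
Hypothesis V_lipschitz : forall p q, `|V p - V q| <= 2^-1 * `|p - q|.

(** The time is clamped to [-1, 1]: the iterates are then defined, and Lipschitz
    with constant [B], on the whole line, and no estimate below carries a domain. *)
Definition picard_step (y : R -> 'rV[R]_n) (t : R) : 'rV[R]_n :=
  p0 + \row_j antiderivative (fun s => V (y s) 0 j) (clamp (- 1) 1 t).

Definition picard (k : nat) : R -> 'rV[R]_n := iter k picard_step (fun=> p0).

Let B0 : 0 <= B. Proof. exact: le_trans (normr_ge0 _) (V_bounded p0). Qed.

Lemma continuous_field_along (y : R -> 'rV[R]_n) j :
  (forall s t : R, `|y s - y t| <= B * `|s - t|) ->
  continuous (fun s => V (y s) 0 j).
Proof.
move=> Ly; apply: (@lipschitz_continuous _ _ _ _ (2^-1 * B)) => s t.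
apply: le_trans (norm_coordB_le _ _ j) _.
by apply: le_trans (V_lipschitz _ _) _; rewrite -mulrA ler_wpM2l.
Qed.

Let unit_in (t : R) : - 1 <= t <= 1 -> - 2 < t < 2.
Proof. by move=> /andP[t1 t2]; apply/andP; split; lra. Qed.

Let clamp_unit (t : R) : - 1 <= clamp (- 1) 1 t <= 1.
Proof. by apply: clamp_itv; lra. Qed.

Let zero_unit : - 1 <= (0 : R) <= 1. Proof. by apply/andP; split; lra. Qed.

Lemma picard_step_lipschitz (y : R -> 'rV[R]_n) :
  (forall s t : R, `|y s - y t| <= B * `|s - t|) ->
  forall s t, `|picard_step y s - picard_step y t| <= B * `|s - t|.
Proof.
move=> Ly s t; apply/row_norm_leP => [|j]; first by rewrite mulr_ge0.
rewrite /picard_step opprD addrACA subrr add0r !mxE.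
have H := @lipschitz_of_derive _ (antiderivative (fun s => V (y s) 0 j))
  (fun s => V (y s) 0 j) (- 1) 1 B.
apply: le_trans (H _ _ _ _ (clamp_unit s) (clamp_unit t)) _.
- move=> u u1; apply: is_derive_antiderivative; last exact: unit_in.
  exact: continuous_field_along.
- by move=> u _; apply: le_trans (norm_coord_le _ _) _.
- by rewrite ler_wpM2l // clamp_lipschitz.
Qed.

(** The factor is the Lipschitz constant of [V] times the length 1 of the
    clamped time interval on either side of 0. *)
Lemma picard_step_contraction (y z : R -> 'rV[R]_n) (e : R) :
  (forall s t : R, `|y s - y t| <= B * `|s - t|) ->
  (forall s t : R, `|z s - z t| <= B * `|s - t|) ->
  (forall t, `|y t - z t| <= e) ->
  forall t, `|picard_step y t - picard_step z t| <= 2^-1 * e.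
Proof.
move=> Ly Lz yz t.
have e0 : 0 <= e := le_trans (normr_ge0 _) (yz 0).
apply/row_norm_leP => [|j]; first by rewrite mulr_ge0.
rewrite /picard_step opprD addrACA subrr add0r !mxE.
pose D : R -> R := antiderivative (fun s => V (y s) 0 j) - antiderivative (fun s => V (z s) 0 j).
pose d (s : R) : R := V (y s) 0 j - V (z s) 0 j.
have dD (u : R) : - 1 <= u <= 1 -> is_derive u 1 D (d u).
  move=> u1; have u2 := unit_in u1; apply: is_deriveB.
    apply: is_derive_antiderivative u2; exact: continuous_field_along.
  apply: is_derive_antiderivative u2; exact: continuous_field_along.
have Hd (u : R) : - 1 <= u <= 1 -> `|d u| <= 2^-1 * e.
  move=> _; apply: le_trans (norm_coordB_le _ _ j) _; apply: le_trans (V_lipschitz _ _) _.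
  by rewrite ler_wpM2l.
have := lipschitz_of_derive dD Hd (clamp_unit t) zero_unit.
rewrite /D !fctE !antiderivative0 !subr0 => /le_trans; apply.
have : `|clamp (- 1) 1 t| <= 1 by rewrite ler_norml clamp_unit.
by move=> H; rewrite -[leRHS]mulr1 ler_wpM2l // mulr_ge0.
Qed.

Lemma picard_lipschitz (k : nat) (s t : R) : `|picard k s - picard k t| <= B * `|s - t|.
Proof.
elim: k s t => [|k IH] s t; first by rewrite /picard /= subrr normr0 mulr_ge0.
exact: picard_step_lipschitz.
Qed.

Lemma picard_step_near (y : R -> 'rV[R]_n) (t : R) :
  (forall s t : R, `|y s - y t| <= B * `|s - t|) -> `|picard_step y t - p0| <= B.
Proof.
move=> Ly.
have -> : p0 = picard_step y (0 : R).
  rewrite /picard_step clamp_id //.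
  by apply/rowP => j; rewrite !mxE antiderivative0 addr0.
have -> : picard_step y t = picard_step y (clamp (- 1) 1 t).
  by rewrite /picard_step (clamp_id (clamp_unit t)).
apply: le_trans (picard_step_lipschitz Ly _ _) _.
have : `|clamp (- 1) 1 t| <= 1 by rewrite ler_norml clamp_unit.
by rewrite subr0 => H; rewrite -[leRHS]mulr1 ler_wpM2l.
Qed.

Lemma picard_increment k t : `|picard k.+1 t - picard k t| <= B * 2^-1 ^+ k.
Proof.
elim: k t => [|k IH] t.
  rewrite expr0 mulr1; apply: picard_step_near => s u.
  by rewrite subrr normr0 mulr_ge0.
have := picard_step_contraction (picard_lipschitz k.+1) (picard_lipschitz k) IH t.
by rewrite mulrCA -exprS.
Qed.

Lemma picard_limit : exists y : R -> 'rV[R]_n,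
  forall k t, `|picard k t - y t| <= 2 * B * 2^-1 ^+ k.
Proof.
have /choice[y Hy] : forall t, exists v : 'rV[R]_n,
    forall k, `|picard k t - v| <= 2 * B * 2^-1 ^+ k.
  move=> t.
  have /choice[l Hl] : forall j, exists l : R,
      forall k, `|picard k t 0 j - l| <= 2 * B * 2^-1 ^+ k.
    move=> j; apply: geometric_cauchy_limit => k.
    exact: le_trans (norm_coordB_le _ _ j) (picard_increment k t).
  exists (\row_j l j) => k; apply/row_norm_leP => [|j].
    by rewrite !mulr_ge0 ?exprn_ge0.
  by rewrite !mxE.
by exists y.
Qed.

Lemma le_geometric_le0 (x C : R) : (forall k : nat, x <= C * 2^-1 ^+ k) -> x <= 0.
Proof.
move=> H; rewrite leNgt; apply/negP => x0.
have C0 : 0 < C by have := H 0%N; rewrite expr0 mulr1; exact: lt_le_trans.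
have cv : (fun k : nat => (2^-1 : R) ^+ k) @ \oo --> (0 : R).
  by apply: cvg_expr; rewrite ger0_norm ?invr_ge0 // invf_lt1 // ltr1n.
have xC : 0 < x / C / 2 by rewrite !divr_gt0.
have /cvgrPdist_le/(_ _ xC)[k _ /(_ k (leqnn k))] := cv.
rewrite sub0r normrN ger0_norm ?exprn_ge0 ?invr_ge0 // => Hk.
have := H k; apply/negP; rewrite -ltNge.
apply: (@le_lt_trans _ _ (C * (x / C / 2))); first by rewrite ler_pM2l.
have -> : C * (x / C / 2) = x / 2 by field; rewrite gt_eqF.
by rewrite ltr_pdivrMr // ltr_pMr // ltr1n.
Qed.

(** The limit of the iterates differs from its image under [picard_step] by at
    most [2 * B * 2^-1 ^+ k] for every [k], hence solves the integral equation; the clamp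
    disappears at interior times. *)
Theorem picard_lindelof_unit : exists y : R -> 'rV[R]_n,
  y 0 = p0 /\ forall t : R, - 1 < t < 1 -> is_derive t 1 y (V (y t)).
Proof.
have [y Hy] := picard_limit.
have Ly (s t : R) : `|y s - y t| <= B * `|s - t|.
  rewrite -subr_le0; apply: (@le_geometric_le0 _ (4 * B)) => k.
  rewrite lerBlDr.
  have -> : y s - y t = (picard k s - picard k t) - (picard k s - y s)
     + (picard k t - y t).
    by apply/rowP => j; rewrite !mxE; ring.
  apply: le_trans (ler_normD _ _) _.
  have := ler_normB (picard k s - picard k t) (picard k s - y s).
  have := Hy k s; have := Hy k t; have := picard_lipschitz k s t.
  set q := _ ^+ k; lra.
have fix_y t : y t = picard_step y t.
  apply/eqP; rewrite -subr_eq0 -normr_le0.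
  apply: (@le_geometric_le0 _ (2 * B)) => k.
  have -> : y t - picard_step y t =
     (picard k.+1 t - picard_step y t) - (picard k.+1 t - y t).
    by apply/rowP => j; rewrite !mxE; ring.
  apply: le_trans (ler_normB _ _) _.
  have := picard_step_contraction (picard_lipschitz k) Ly (Hy k) t.
  have := Hy k.+1 t; rewrite exprS /picard iterS -/(picard k).
  set q := _ ^+ k; lra.
exists y; split.
  rewrite fix_y /picard_step clamp_id //.
  by apply/rowP => j; rewrite !mxE antiderivative0 addr0.
move=> t /andP[t1 t2].
have dy j : is_derive t 1 (fun t => y t 0 j) (V (y t) 0 j).
  pose P := antiderivative (fun s => V (y s) 0 j).
  have dP : is_derive t 1 P (V (y t) 0 j).
    apply: is_derive_antiderivative; first exact: continuous_field_along.
    by apply/andP; split; lra.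
  have dPc : is_derive t 1 (cst (p0 0 j) + P) (V (y t) 0 j).
    apply: is_derive_eq (is_deriveD (is_derive_cst _ _ _) dP) _.
    exact: add0r.
  apply: near_eq_is_derive dPc.
  near=> s; rewrite fctE [in RHS]fix_y /picard_step !mxE clamp_id //.
  apply/andP; split; apply: ltW; near: s.
    exact: lt_nbhsr.
  exact: lt_nbhsl.
have derive_y : derivable y t 1.
  by apply/derivable_mxP => i j; rewrite ord1; have [] := dy j.
apply: DeriveDef => //; rewrite derive_mx //; apply/rowP => j.
by rewrite mxE; have [_ ->] := dy j.
Unshelve. all: by end_near. Qed.

End Picard.

Section LocalLipschitz.
Context {R : realType} {n : nat}.

Lemma norm_linear_rV (W : normedModType R) (l : {linear 'rV[R]_n -> W}) (K : R)
    (v : 'rV[R]_n) : 0 <= K ->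
  (forall j, `|l (delta_mx 0 j)| <= K) -> `|l v| <= n%:R * K * `|v|.
Proof.
move=> K0 HK; rewrite {1}(row_sum_delta v) linear_sum.
apply: le_trans (ler_norm_sum _ _ _) _.
apply: le_trans (_ : \sum_(j < n) `|v| * K <= _); last first.
  by rewrite sumr_const card_ord -[leLHS]mulr_natl -mulrA (mulrC K).
apply: ler_sum => j _; rewrite linearZ normrZ ler_pM //.
exact: norm_coord_le.
Qed.

(** The partial derivatives are bounded near [e] by continuity, and a ball
    contains the segments along which the mean value theorem is applied. *)
Lemma locally_lipschitz (U : set 'rV[R]_n) (f : 'rV[R]_n -> 'rV[R]_n)
    (e : 'rV[R]_n) : open U -> smooth_on U f -> U e ->
  exists r L : R, [/\ 0 < r, 0 <= L, forall p, `|p - e| <= r -> U p &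
    forall p q, `|p - e| <= r -> `|q - e| <= r -> `|f p - f q| <= L * `|p - q|].
Proof.
move=> oU sf Ue.
pose D j : 'rV[R]_n -> 'rV[R]_n := 'D_(delta_mx 0 j : 'rV[R]_n) f.
pose K := \sum_(j < n) (`|D j e| + 1).
have K0 : 0 <= K by apply: sumr_ge0 => j _; rewrite addr_ge0.
have nK j : \forall p \near e, `|D j p| <= K.
  have cD : {for e, continuous (D j)}.
    exact: smooth_on_continuous (smooth_on_derive _ oU sf) Ue.
  have : \forall p \near e, `|D j p| < `|D j e| + 1.
    by apply: near_norm_lt cD _; rewrite ltrDl.
  apply: filterS => p /ltW /le_trans; apply.
  rewrite /K (bigD1 j) //= lerDl; apply: sumr_ge0 => i _.
  by rewrite addr_ge0.
have nU : \forall p \near e, U p by exact: open_nbhs_nbhs.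
have nUK : \forall p \near e, U p /\ forall j, `|D j p| <= K.
  exact: (filterI nU (filter_forall _ nK)).
have /nbhs_normP[r /= r0 Hr] := nUK.
have ball_in p : `|p - e| <= r / 2 -> U p /\ forall j, `|D j p| <= K.
  move=> pe; apply: Hr; rewrite /ball_ /= distrC; apply: le_lt_trans pe _.
  by rewrite ltr_pdivrMr // ltr_pMr // ltr1n.
exists (r / 2), (n%:R * K); split; first by rewrite divr_gt0.
- by rewrite mulr_ge0.
- by move=> p /ball_in[].
move=> p q pe qe.
have seg (s : R) : 0 <= s <= 1 -> `|q + s *: (p - q) - e| <= r / 2.
  move=> /andP[s0 s1].
  have -> : q + s *: (p - q) - e = (1 - s) *: (q - e) + s *: (p - e).
    by apply/rowP => j; rewrite !mxE; ring.
  apply: le_trans (ler_normD _ _) _; rewrite !normrZ (ger0_norm s0).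
  rewrite ger0_norm ?subr_ge0 //.
  have : (1 - s) * `|q - e| <= (1 - s) * (r / 2) by rewrite ler_wpM2l ?subr_ge0.
  have : s * `|p - e| <= s * (r / 2) by rewrite ler_wpM2l.
  by set h := r / 2; lra.
apply/row_norm_leP => [|j]; first by rewrite !mulr_ge0.
have dfx (x : 'rV[R]_n) : U x -> differentiable f x.
  exact: smooth_on_differentiable.
have dfj (s : R) : 0 <= s <= 1 ->
    differentiable (fun x => f x 0 j) (q + s *: (p - q)).
  move=> /seg/ball_in[Us _].
  by have [] := diff_coord j (dfx _ Us).
have [c /seg/ball_in[Uc Kc]] := mean_value_line ltr01 dfj.
rewrite scale1r subrKC mulr1 !mxE => ->.
rewrite deriveE; last by have [] := diff_coord j (dfx _ Uc).
have [_ ->] := diff_coord j (dfx _ Uc).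
apply: le_trans (norm_coord_le _ _) _.
apply: norm_linear_rV => // i; apply: le_trans (Kc i).
by rewrite /D deriveE //; exact: dfx.
Qed.

End LocalLipschitz.

Section LocalSolution.
Context {R : realType} {n : nat}.

(** The field is composed with the projection onto a small box around [e],
    which is a ball of the sup norm: it becomes bounded and globally Lipschitz, and
    a rescaling of time makes the Lipschitz constant at most 1/2.  For small times
    the solution stays in the box, where the field is unchanged. *)
Lemma local_solution_exists (U : set 'rV[R]_n) (V : 'rV[R]_n -> 'rV[R]_n)
    (e : 'rV[R]_n) : open U -> smooth_on U V -> U e ->
  exists x : R -> 'rV[R]_n, x 0 = e /\
    \forall t \near (0 : R), is_derive (t : R) 1 x (V (x t)).
Proof.
move=> oU sV Ue.
have [r [L [r0 L0 rU VL]]] := locally_lipschitz oU sV Ue.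
pose proj (p : 'rV[R]_n) : 'rV[R]_n :=
  \row_j clamp (e 0 j - r) (e 0 j + r) (p 0 j).
have projr p : `|proj p - e| <= r.
  apply/row_norm_leP => [|j]; first exact: ltW.
  have er : e 0 j - r <= e 0 j + r by lra.
  rewrite !mxE; have /andP[] := clamp_itv (p 0 j) er.
  by move: (clamp _ _ _) => c c1 c2; rewrite ler_norml; apply/andP; split; lra.
have projL p q : `|proj p - proj q| <= `|p - q|.
  apply/row_norm_leP => // j; rewrite !mxE.
  by apply: le_trans (clamp_lipschitz _ _ _ _) _; exact: norm_coordB_le.
have projid p : `|p - e| <= r -> proj p = p.
  move=> pe; apply/rowP => j; rewrite mxE clamp_id //.
  have := le_trans (norm_coordB_le p e j) pe.
  by rewrite ler_norml => /andP[? ?]; apply/andP; split; lra.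
(* Time step for which [h * L <= 1 / 2], also when [L = 0]. *)
pose h := (2 * (L + 1))^-1.
have L1 : 0 < L + 1 by rewrite ltr_wpDl.
have h0 : 0 < h by rewrite invr_gt0 mulr_gt0.
have e0 : `|e - e| <= r by rewrite subrr normr0 ltW.
pose W p := h *: V (proj p).
have WB p : `|W p| <= h * (`|V e| + L * r).
  rewrite normrZ gtr0_norm // ler_pM2l // -[V _](subrKC (V e)).
  apply: le_trans (ler_normD _ _) _; rewrite lerD2l.
  by apply: le_trans (VL _ _ (projr p) e0) _; rewrite ler_wpM2l.
have WL p q : `|W p - W q| <= 2^-1 * `|p - q|.
  rewrite /W -scalerBr normrZ gtr0_norm //.
  apply: le_trans (_ : h * (L * `|p - q|) <= _).
    rewrite ler_pM2l //; apply: le_trans (VL _ _ (projr p) (projr q)) _.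
    by rewrite ler_wpM2l.
  rewrite mulrA ler_wpM2r // /h invfM -mulrA ler_piMr ?invr_ge0 //.
  by rewrite ler_pdivrMl // mulr1 lerDl.
have [y [y0 dy]] := picard_lindelof_unit e WB WL.
have hn0 : h != 0 by rewrite gt_eqF.
exists (fun t => y (t / h)); split; first by rewrite mul0r.
have cy : {for 0, continuous y}.
  apply: differentiable_continuous; apply/derivable1_diffP.
  by have [|] := dy 0; [lra|].
have c0 : (fun t : R => t / h) @ (0 : R) --> (0 : R).
  by rewrite -[X in _ --> X](mul0r h^-1); apply: cvgMl; exact: cvg_id.
have ny : \forall t \near (0 : R), `|y (t / h) - e| <= r.
  have /cvgrPdist_le/(_ _ r0) := @cvg_comp _ _ _ _ _ _ _ _ c0 cy.
  by apply: filterS => t; rewrite y0 distrC.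
have nt : \forall t \near (0 : R), `|t / h| < 1.
  by apply: (cvgr_norm_lt _ c0); rewrite normr0.
apply: filterS2 ny nt => t yt; rewrite ltr_norml => ht.
have := dy _ ht; rewrite /W projid // => dyt.
rewrite -[t / h]add0r in dyt.
have := is_derive_affine dyt; rewrite scalerA mulVf // scale1r add0r.
by under eq_fun do rewrite add0r.
Qed.

(** The function [u t * expR (- C * t)] is nonincreasing. *)
Lemma gronwall (u du : R -> R) (C b : R) : 0 <= b ->
  (forall t : R, 0 <= t <= b -> is_derive t 1 u (du t)) ->
  (forall t : R, 0 <= t <= b -> du t <= C * u t) -> u 0 <= 0 -> u b <= 0.
Proof.
rewrite le_eqVlt => /predU1P[<- //|b0] Hu Hdu u0.
pose v (t : R) : R := u t * expR (- C * t).
pose dv (t : R) : R := (du t - C * u t) * expR (- C * t).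
have dE (t : R) : is_derive t 1 (fun t : R => expR (- C * t)) (- C * expR (- C * t)).
  have d1 : is_derive t 1 (fun t : R => - C * t) (- C).
    have := @is_deriveZ _ _ _ _ (- C) _ _ _ (is_derive_id t (1 : R)).
    by rewrite scaler1.
  by have := is_derive1_comp (is_derive_expR (- C * t)) d1; rewrite mulrC.
have dvt (t : R) : 0 <= t <= b -> is_derive t 1 v (dv t).
  move=> tb; apply: is_derive_eq (is_deriveM (Hu t tb) (dE t)) _.
  by rewrite /dv /GRing.scale /=; ring.
have cv : {within `[0, b], continuous v}.
  by apply: derivable_within_continuous => x; rewrite in_itv /= => /dvt[].
have Ho x : x \in `]0, b[%R -> is_derive x 1 v (dv x).
  by rewrite in_itv /= => /andP[/ltW x0 /ltW xb]; apply: dvt; rewrite x0.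
have [c /andP[/ltW c0 /ltW cb]] := MVT b0 Ho cv.
rewrite subr0 /v mulr0 expR0 mulr1 => E.
have dvc : dv c <= 0.
  rewrite /dv mulr_le0_ge0 ?expR_ge0 // subr_le0; apply: Hdu.
  by rewrite c0 cb.
have : u b * expR (- C * b) <= 0.
  by rewrite -(subrK (u 0) (_ * _)) E -[leRHS]addr0 lerD // mulr_le0_ge0 // ltW.
by rewrite pmulr_lle0 // expR_gt0.
Qed.

(** The squared Euclidean distance [u] of two solutions satisfies
    [`|u'| <= 2 n L u], so it vanishes on both sides of 0.  The Euclidean norm is
    used because, unlike the sup norm, its square is differentiable. *)
Lemma solution_unique (S : set 'rV[R]_n) (V : 'rV[R]_n -> 'rV[R]_n) (L d : R)
    (x y : R -> 'rV[R]_n) : 0 <= L ->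
  (forall p q, S p -> S q -> `|V p - V q| <= L * `|p - q|) ->
  (forall t : R, `|t| < d -> S (x t) /\ is_derive t 1 x (V (x t))) ->
  (forall t : R, `|t| < d -> S (y t) /\ is_derive t 1 y (V (y t))) ->
  x 0 = y 0 -> forall t : R, `|t| < d -> x t = y t.
Proof.
move=> L0 VL Hx Hy xy0.
pose w j (t : R) : R := x t 0 j - y t 0 j.
pose dw j (t : R) : R := V (x t) 0 j - V (y t) 0 j.
have coordP (z : R -> 'rV[R]_n) (t : R) dz j : is_derive t 1 z dz ->
    is_derive t 1 (fun t => z t 0 j) (dz 0 j).
  move=> [zd <-].
  have zd' : differentiable z t by apply/derivable1_diffP.
  have [dzj Ezj] := diff_coord j zd'.
  apply: DeriveDef; first exact: diff_derivable.
  by rewrite !deriveE.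
have dwP j (t : R) : `|t| < d -> is_derive t 1 (w j) (dw j t).
  move=> td; apply: is_deriveB.
    by apply: coordP; have [] := Hx t td.
  by apply: coordP; have [] := Hy t td.
pose u (t : R) : R := \sum_(j < n) w j t ^+ 2.
pose du (t : R) : R := \sum_(j < n) (2 * w j t * dw j t).
have duP (t : R) : `|t| < d -> is_derive t 1 u (du t).
  move=> td.
  have -> : u = \sum_(j < n) (w j) ^+ 2 by apply/funext => s; rewrite fct_sumE.
  apply: is_derive_sum => j; apply: is_derive_eq (is_deriveX _ (dwP j t td)) _.
  by rewrite expr1 /GRing.scale.
have u_ge j t : w j t ^+ 2 <= u t.
  by rewrite /u (bigD1 j) //= lerDl sumr_ge0 // => i _; exact: sqr_ge0.
have u0 : u 0 = 0.
  by rewrite /u big1 // => j _; rewrite /w xy0 subrr expr0n.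
have duC (t : R) : `|t| < d -> `|du t| <= (n%:R * (2 * L)) * u t.
  move=> td.
  have nw : `|x t - y t| ^+ 2 <= u t.
    have : `|x t - y t| <= Num.sqrt (u t).
      apply/row_norm_leP => [|j]; first exact: sqrtr_ge0.
      by rewrite !mxE -sqrtr_sqr ler_wsqrtr //; exact: u_ge.
    move=> H; rewrite -[leRHS]sqr_sqrtr; last by rewrite sumr_ge0 // => i _; rewrite sqr_ge0.
    by rewrite ler_pXn2r // ?nnegrE ?sqrtr_ge0.
  apply: le_trans (ler_norm_sum _ _ _) _.
  apply: le_trans (_ : \sum_(j < n) 2 * L * u t <= _); last first.
    by rewrite sumr_const card_ord -[leLHS]mulr_natl mulrA.
  apply: ler_sum => j _; rewrite -mulrA normrM ger0_norm // -mulrA ler_pM2l //.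
  apply: le_trans (_ : L * `|x t - y t| ^+ 2 <= _); last by rewrite ler_wpM2l.
  rewrite normrM expr2 mulrCA ler_pM //.
    exact: norm_coordB_le.
  apply: le_trans (norm_coordB_le _ _ _) _.
  by apply: VL; [have [] := Hx t td|have [] := Hy t td].
have key (t : R) : `|t| < d -> u t <= 0.
  have [t0|/ltW t0] := leP 0 t; rewrite ?(ger0_norm t0) ?(ler0_norm t0) => td.
    have in_d (s : R) : 0 <= s <= t -> `|s| < d.
      by move=> /andP[s0 st]; rewrite ger0_norm //; exact: le_lt_trans td.
    apply: (@gronwall u du (n%:R * (2 * L)) t t0); last by rewrite u0.
      by move=> s st; apply: duP; exact: in_d.
    by move=> s st; apply: le_trans (ler_norm _) (duC s (in_d s st)).
  have in_d (s : R) : 0 <= s <= - t -> `|- s| < d.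
    by move=> /andP[s0 st]; rewrite normrN ger0_norm //; exact: le_lt_trans td.
  have nt0 : 0 <= - t by rewrite oppr_ge0.
  rewrite -[t]opprK.
  apply: (@gronwall (fun s => u (- s)) (fun s => - du (- s)) (n%:R * (2 * L)) (- t) nt0).
  - move=> s st.
    have := is_derive1_comp (duP _ (in_d s st)) (is_deriveNid s (1 : R)).
    by rewrite mulrN1.
  - move=> s st; apply: le_trans (duC (- s) (in_d s st)).
    by rewrite -normrN ler_norm.
  - by rewrite oppr0 u0.
move=> t td; apply/rowP => j; apply/eqP; rewrite -subr_eq0 -sqrf_eq0.
by rewrite eq_le sqr_ge0 andbT; exact: le_trans (u_ge j t) (key t td).
Qed.

End LocalSolution.

(** * Charts *)

Section Charts.
Context {R : realType} {n : nat} {M : topologicalType}.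
Implicit Type c : chart R n M.

Lemma chart_codom_map c x : chart_dom c x -> chart_codom c (c x).
Proof. by move=> cx; exists x. Qed.

Lemma chart_dom_inv c p : chart_codom c p -> chart_dom c (chart_inv c p).
Proof. by move=> [x cx <-]; rewrite chart_mapK. Qed.

Lemma chart_invK c p : chart_codom c p -> c (chart_inv c p) = p.
Proof. by move=> [x cx <-]; rewrite chart_mapK. Qed.

Lemma open_chart_codom c : open (chart_codom c).
Proof. exact: open_chart_image. Qed.

Lemma near_chart_dom c x : chart_dom c x -> \near x, chart_dom c x.
Proof. by move=> cx; apply: open_nbhs_nbhs; split=> //; exact: open_chart_dom. Qed.

End Charts.

Section ChartVectors.
Context {R : realType} {n : nat} {M : manifoldType R n}.

Lemma differentiable_transition (c d : chart R n M) (x : M) :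
  atlas c -> atlas d -> chart_dom c x -> chart_dom d x ->
  differentiable (d \o chart_inv c) (c x).
Proof.
move=> ac ad cx dx; apply: smooth_on_differentiable (atlas_compatible _ _ ac ad) _.
by split=> /=; [exact: chart_codom_map|rewrite chart_mapK].
Qed.

(** A change of charts has a local inverse, namely the opposite change. *)
Lemma vec_of_coord_inj (c : chart R n M) (x : M) (y : 'rV[R]_n) :
  atlas c -> chart_dom c x -> y != 0 -> vec_of_coord c x y != 0.
Proof.
move=> ac cx; apply: contra_neq => y0.
have ad := chart_at_atlas x; have dx := chart_at_dom x.
have d1 := differentiable_transition ac ad cx dx.
have Ecx : chart_at x (chart_inv c (c x)) = chart_at x x by rewrite chart_mapK.
have d2 : differentiable (c \o chart_inv (chart_at x)) ((chart_at x \o chart_inv c) (c x)).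
  by rewrite /= Ecx; exact: differentiable_transition ad ac dx cx.
apply: (diff_left_inverse d1 d2) y0.
have n1 : \forall q \near c x, chart_codom c q.
  apply: open_nbhs_nbhs; split; first exact: open_chart_codom.
  exact: chart_codom_map.
have n2 : \forall q \near c x, chart_dom (chart_at x) (chart_inv c q).
  apply: (@chart_inv_continuous _ _ _ c _ (chart_codom_map cx)).
  by rewrite chart_mapK //; exact: near_chart_dom.
by apply: filterS2 n1 n2 => q cq dq /=; rewrite chart_mapK // chart_invK.
Qed.

End ChartVectors.

(** * Finsler metrics in coordinates *)

Section FinslerCoordinates.
Context {R : realType} {n : nat} {M : manifoldType R n}.
Variable F : forall x : M, tangent x -> R.
Hypothesis finslerF : is_finsler F.
Variable c : chart R n M.
Hypothesis atlas_c : atlas c.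

Notation E := ('rV[R]_n * 'rV[R]_n)%type.
Notation L := (coord_metric2 F c).
Notation g := (fundamental_mx F c).

Definition slit_dom : set E := [set p | chart_codom c p.1 /\ p.2 != 0].
Notation U := slit_dom.

Lemma open_slit_dom : open U.
Proof.
have -> : U = fst @^-1` (chart_codom c) `&` snd @^-1` (~` [set 0]).
  apply/seteqP; split=> p [cp p2]; split => //=; first by apply/eqP.
  exact/eqP.
apply: openI; apply: open_comp.
- by move=> z _; exact: cvg_fst.
- exact: open_chart_image.
- by move=> z _; exact: cvg_snd.
- by rewrite openC; apply: accessible_closed_set1; apply: hausdorff_accessible; exact: norm_hausdorff.
Qed.

Lemma smooth_coord_metric2 : smooth_on U L.
Proof.
move=> k; have sF := finsler_smooth finslerF atlas_c.
by apply: Ck_onM; [exact: open_slit_dom|exact: sF|exact: sF].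
Qed.

Lemma differentiable_metric2 p : U p -> differentiable L p.
Proof. exact: smooth_on_differentiable smooth_coord_metric2. Qed.

Lemma smooth_metric2_derive v : smooth_on U ('D_v L).
Proof. exact: smooth_on_derive open_slit_dom smooth_coord_metric2. Qed.

Lemma differentiable_metric2_derive v p : U p -> differentiable ('D_v L) p.
Proof. exact: smooth_on_differentiable (smooth_metric2_derive v). Qed.

Lemma metric2_homogeneous p (a : R) : 0 <= a -> L (p.1, a *: p.2) = a ^+ 2 * L p.
Proof.
move=> a0; rewrite /coord_metric2 /coord_metric /= -exprMn; congr (_ ^+ 2).
rewrite -(finsler_homogeneous finslerF) //; congr F.
exact: linearZ.
Qed.

Lemma slit_dom_scale p (a : R) : 0 < a -> U p -> U (p.1, a *: p.2).
Proof.
move=> a0 [cp p2]; split=> //=.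
by rewrite scaler_eq0 negb_or p2 gt_eqF.
Qed.

Lemma metric2_derive_homogeneous p (a : R) v : 0 < a -> U p ->
  'D_(inr_row v) L (p.1, a *: p.2) = a * 'D_(inr_row v) L p.
Proof.
move=> a0 Up; have Uap := slit_dom_scale a0 Up.
have line (q : E) : U q ->
    is_derive (0 : R) 1 (fun s : R => L (q + s *: inr_row v)) ('D_(inr_row v) L q).
  move=> Uq; have dq : differentiable L (q + 0 *: inr_row v).
    by rewrite scale0r addr0; exact: differentiable_metric2.
  by have := is_derive_line dq; rewrite scale0r addr0.
have HL (s : R) : L ((p.1, a *: p.2) + (0 + s * a) *: inr_row v) =
    a ^+ 2 * L (p + s *: inr_row v).
  rewrite -metric2_homogeneous ?ltW //=; congr (L _).
  rewrite /inr_row; case: p {Up Uap} => x y; congr pair => /=.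
    by rewrite !scaler0.
  by rewrite add0r scalerDr scalerA mulrC.
have H1 := line _ Uap.
have H2 : is_derive (0 : R) 1 (fun s : R => a ^+ 2 * L (p + s *: inr_row v))
    (a ^+ 2 * 'D_(inr_row v) L p).
  exact: is_deriveZ (line _ Up).
have H3 : is_derive (0 : R) 1 (fun s : R => a ^+ 2 * L (p + s *: inr_row v))
    (a * 'D_(inr_row v) L (p.1, a *: p.2)).
  have H0 : is_derive (0 + 0 * a) 1 (fun s : R => L ((p.1, a *: p.2) + s *: inr_row v))
      ('D_(inr_row v) L (p.1, a *: p.2)).
    by rewrite mul0r addr0.
  have := is_derive_affine H0.
  by under eq_fun do rewrite HL.
have an0 : a != 0 by rewrite gt_eqF.
have [_ E2] := H2; have [_ E3] := H3; apply: (mulfI an0).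
by rewrite -E3 E2 expr2 mulrA.
Qed.

Lemma near_one_plus_gt0 : \forall s \near (0 : R), 0 < 1 + s.
Proof.
have : \forall s \near (0 : R), - 1 < s by apply: lt_nbhsr; rewrite oppr_lt0.
by apply: filterS => s s1; lra.
Qed.

Lemma fiber_line (p : E) (s : R) : p + s *: inr_row p.2 = (p.1, (1 + s) *: p.2).
Proof.
case: p => x y; rewrite /inr_row; congr pair => /=.
  by rewrite scaler0 addr0.
by rewrite scalerDl scale1r.
Qed.

Lemma euler_metric2 p : U p -> 'd L p (inr_row p.2) = 2 * L p.
Proof.
move=> Up; apply: (derive_homogeneous (m := 2)); first exact: differentiable_metric2.
apply: filterS near_one_plus_gt0 => s s0.
by rewrite fiber_line metric2_homogeneous // ltW.
Qed.

(** The fibre derivative of a function homogeneous of degree 2 is homogeneous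
    of degree 1. *)
Lemma euler_metric2_derive p v : U p ->
  'd ('D_(inr_row v) L) p (inr_row p.2) = 'D_(inr_row v) L p.
Proof.
move=> Up; rewrite -[RHS]mul1r; apply: (derive_homogeneous (m := 1)).
  exact: differentiable_metric2_derive.
apply: filterS near_one_plus_gt0 => s s0.
by rewrite fiber_line metric2_derive_homogeneous // expr1.
Qed.


Lemma dyE k : dy R k = inr_row (delta_mx 0 k : 'rV[R]_n). Proof. by []. Qed.

Lemma fundamental_mxE i j p : g p i j = 2^-1 * 'D_(dy R i) ('D_(dy R j) L) p.
Proof. by rewrite mxE. Qed.

Lemma fundamental_mx_sym i j p : U p -> g p i j = g p j i.
Proof.
move=> Up; apply: etrans (fundamental_mxE _ _ _) _.
apply: etrans _ (esym (fundamental_mxE _ _ _)); apply: (congr1 (GRing.mul 2^-1)).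
exact: (schwarz_real _ _ open_slit_dom smooth_coord_metric2 Up).
Qed.

Lemma differentiable_fundamental_mx i j p : U p ->
  differentiable (fun q => g q i j) p.
Proof.
move=> Up.
have -> : (fun q => g q i j) = 2^-1 \*: ('D_(dy R i) ('D_(dy R j) L)).
  by apply/funext => q; rewrite fundamental_mxE.
apply: differentiableZ.
apply: smooth_on_differentiable Up.
exact: smooth_on_derive open_slit_dom (smooth_metric2_derive _).
Qed.

Lemma derive_metric2_expand v w p : U p ->
  'd ('D_(inr_row v) L) p w = \sum_j v 0 j * 'd ('D_(dy R j) L) p w.
Proof. exact: diff_derive_expand open_slit_dom smooth_coord_metric2. Qed.

(** Euler's identity for [F^2]_(y^l), which is homogeneous of degree 1. *)
Lemma fundamental_mx_contract l p : U p ->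
  \sum_k p.2 0 k * g p k l = 2^-1 * 'D_(dy R l) L p.
Proof.
move=> Up; rewrite dyE -(euler_metric2_derive _ Up).
rewrite (diff_linear_expand _ _ (differentiable_metric2_derive _ Up)) mulr_sumr.
by apply: eq_bigr => k _; rewrite fundamental_mxE mulrCA.
Qed.

Lemma derive_contract (f : 'I_n -> E -> R) (h : E -> R) (v p : E) :
  (forall k, differentiable (f k) p) -> U p ->
  (forall q, U q -> \sum_k q.2 0 k * f k q = h q) ->
  \sum_k p.2 0 k * 'D_v (f k) p = 'D_v h p - \sum_k v.2 0 k * f k p.
Proof.
move=> df Up Hh; apply/eqP; rewrite eq_sym subr_eq; apply/eqP.
have dp k := differentiable_snd_coord k p.
have dm k : differentiable (fun q : E => q.2 0 k * f k q) p.
  by apply: differentiableM; [have [] := dp k|].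
have [ds Es] := is_diff_bigsum v dm.
have nh := open_eq_near open_slit_dom Hh Up.
rewrite -(near_eq_derive _ nh) deriveE // Es -big_split /=.
apply: eq_bigr => k _; have [dk Ek] := dp k.
apply: etrans (diff_mul _ dk (df k)) _.
by rewrite Ek deriveE //; congr (_ + _); exact: mulrC.
Qed.

(** Differentiating [y^k g_kl = [F^2]_(y^l) / 2] along [dy R m] gives
    [g_ml + y^k d g_kl / d y^m] on the left and [g_ml] on the right; so the second
    term vanishes and the nonlinear connection drops out, whatever it is. *)
Lemma horizontal_contract j l p : U p ->
  \sum_k p.2 0 k * horizontal_derive F c j (fun q => g q k l) p =
  2^-1 * 'D_(dx R j) ('D_(dy R l) L) p.
Proof.
move=> Up.
have dgl k : differentiable (fun q => g q k l) p by exact: differentiable_fundamental_mx.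
pose h q := 2^-1 * 'D_(dy R l) L q.
have Dh v : 'D_v h p = 2^-1 * 'D_v ('D_(dy R l) L) p.
  rewrite -[RHS]/(2^-1 *: _) -deriveZ //.
  by apply: diff_derivable; exact: differentiable_metric2_derive.
have H v : \sum_k p.2 0 k * 'D_v (fun q => g q k l) p =
    2^-1 * 'D_v ('D_(dy R l) L) p - \sum_k v.2 0 k * g p k l.
  rewrite -Dh; apply: derive_contract => // q Uq.
  exact: fundamental_mx_contract.
have Hy m : \sum_k p.2 0 k * 'D_(dy R m) (fun q => g q k l) p = 0.
  rewrite H (bigD1 m) //= mxE !eqxx mul1r big1 => [|k km].
    by rewrite addr0 fundamental_mxE subrr.
  by rewrite mxE (negPf km) andbF mul0r.
have Hx : \sum_k p.2 0 k * 'D_(dx R j) (fun q => g q k l) p =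
    2^-1 * 'D_(dx R j) ('D_(dy R l) L) p.
  by rewrite H big1 ?subr0 // => k _; rewrite mxE mul0r.
rewrite /horizontal_derive; under eq_bigr do rewrite mulrBr.
rewrite sumrB Hx -[RHS]subr0; congr (_ - _).
under eq_bigr do rewrite mulr_sumr.
rewrite exchange_big big1 //= => m _.
under eq_bigr do rewrite mulrCA.
by rewrite -mulr_sumr Hy mulr0.
Qed.

Lemma horizontal_contract_sym j l p : U p ->
  \sum_k p.2 0 k * horizontal_derive F c j (fun q => g q l k) p =
  2^-1 * 'D_(dx R j) ('D_(dy R l) L) p.
Proof.
move=> Up; rewrite -horizontal_contract //; apply: eq_bigr => k _; congr (_ * _).
have ng : \forall q \near p, g q l k = g q k l.
  apply: (open_eq_near open_slit_dom) Up => q Uq; exact: fundamental_mx_sym.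
rewrite /horizontal_derive (near_eq_derive _ ng); congr (_ - _).
by apply: eq_bigr => m _; rewrite (near_eq_derive _ ng).
Qed.

(** Euler's identity [y^k [F^2]_(y^k) = 2 F^2], differentiated with [y] fixed. *)
Lemma horizontal_contract2 l p : U p ->
  \sum_k p.2 0 k * 'D_(dx R l) ('D_(dy R k) L) p = 2 * 'D_(dx R l) L p.
Proof.
move=> Up; pose h q := 2 * L q.
have -> : 2 * 'D_(dx R l) L p = 'D_(dx R l) h p.
  rewrite -[LHS]/(2 *: _) -deriveZ //.
  by apply: diff_derivable; exact: differentiable_metric2.
rewrite (derive_contract (h := h)) //.
- by rewrite [X in _ - X]big1 ?subr0 // => k _; rewrite mxE mul0r.
- by move=> k; exact: differentiable_metric2_derive.
- move=> q Uq; rewrite /h -euler_metric2 //.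
  by rewrite (diff_linear_expand _ _ (differentiable_metric2 Uq)).
Qed.

(** The spray coefficients with lowered index, [4 g_li G^i]. *)
Definition spray_covector (p : E) l : R :=
  \sum_k p.2 0 k * 'D_(dx R k) ('D_(dy R l) L) p - 'D_(dx R l) L p.

(** Each of the three terms of the Chern coefficients is contracted by
    [horizontal_contract]; what is left are twice the spray coefficients. *)
Lemma chern_contract i (p : E) : U p ->
  \sum_j \sum_k p.2 0 j * p.2 0 k * chern_coef F c i j k p =
  2^-1 * \sum_l invmx (g p) i l * spray_covector p l.
Proof.
move=> Up; rewrite /chern_coef.
pose a j k l := horizontal_derive F c j (fun q => g q l k) p
  + horizontal_derive F c k (fun q => g q j l) p
  - horizontal_derive F c l (fun q => g q j k) p.
have -> : \sum_j \sum_k p.2 0 j * p.2 0 k *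
    (2^-1 * \sum_l invmx (g p) i l * a j k l) =
    2^-1 * \sum_l invmx (g p) i l *
      (\sum_j \sum_k p.2 0 j * (p.2 0 k * a j k l)).
  transitivity (\sum_j \sum_k \sum_l 2^-1 *
      (invmx (g p) i l * (p.2 0 j * (p.2 0 k * a j k l)))).
    apply: eq_bigr => j _; apply: eq_bigr => k _; rewrite !mulr_sumr.
    by apply: eq_bigr => l _; ring.
  under eq_bigr do rewrite exchange_big /=.
  rewrite exchange_big /= mulr_sumr; apply: eq_bigr => l _.
  rewrite mulr_sumr mulr_sumr; apply: eq_bigr => j _.
  by rewrite mulr_sumr mulr_sumr; apply: eq_bigr => k _.
congr (_ * _); apply: eq_bigr => l _; congr (_ * _).
pose y j := p.2 0 j.
have S1 : \sum_j \sum_k y j * (y k * horizontal_derive F c j (fun q => g q l k) p) =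
    2^-1 * \sum_j y j * 'D_(dx R j) ('D_(dy R l) L) p.
  rewrite mulr_sumr; apply: eq_bigr => j _.
  by rewrite -mulr_sumr horizontal_contract_sym // mulrCA.
have S2 : \sum_j \sum_k y j * (y k * horizontal_derive F c k (fun q => g q j l) p) =
    2^-1 * \sum_j y j * 'D_(dx R j) ('D_(dy R l) L) p.
  rewrite exchange_big mulr_sumr; apply: eq_bigr => k _.
  under eq_bigr do rewrite mulrCA.
  by rewrite -mulr_sumr horizontal_contract // mulrCA.
have S3 : \sum_j \sum_k y j * (y k * horizontal_derive F c l (fun q => g q j k) p) =
    'D_(dx R l) L p.
  rewrite exchange_big; transitivity (2^-1 * (\sum_k y k * 'D_(dx R l) ('D_(dy R k) L) p)).
    rewrite mulr_sumr; apply: eq_bigr => k _.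
    under eq_bigr do rewrite mulrCA.
    by rewrite -mulr_sumr horizontal_contract // mulrCA.
  apply: etrans (congr1 (GRing.mul 2^-1) (horizontal_contract2 l Up)) _.
  by apply: mulKf; rewrite pnatr_eq0.
rewrite /spray_covector.
transitivity (\sum_j \sum_k y j * (y k * horizontal_derive F c j (fun q => g q l k) p)
  + \sum_j \sum_k y j * (y k * horizontal_derive F c k (fun q => g q j l) p)
  - \sum_j \sum_k y j * (y k * horizontal_derive F c l (fun q => g q j k) p)).
  rewrite -big_split -sumrB; apply: eq_bigr => j _ /=.
  rewrite -big_split -sumrB; apply: eq_bigr => k _ /=.
  by rewrite /a -/(y j) -/(y k); ring.
rewrite S1 S2 S3; congr (_ - _).
by rewrite -mulrDl -[2^-1]div1r -splitr mul1r.
Qed.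


(** Coordinate vectors depend linearly on their coordinates, so both iterated
    derivatives are taken along lines of the fibre. *)
Lemma fundamental_form_coord p u v : U p ->
  let X z := vec_of_coord c (chart_inv c p.1) z in
  fundamental_form F (X p.2) (X u) (X v) =
  2^-1 * 'D_(inr_row u) ('D_(inr_row v) L) p.
Proof.
move=> Up X; apply: (congr1 (GRing.mul 2^-1)).
have line (q : E) (w : E) (h : E -> R) : differentiable h q ->
    derive1 (fun t : R => h (q + t *: w)) 0 = 'D_w h q.
  move=> dq; have dq0 : differentiable h (q + 0 *: w) by rewrite scale0r addr0.
  by have [_] := is_derive_line dq0; rewrite scale0r addr0 derive1E.
have HL (s t : R) : F (X p.2 + s *: X u + t *: X v) ^+ 2 =
    L (p + s *: inr_row u + t *: inr_row v).
  rewrite /coord_metric2 /coord_metric /= !scaler0 !addr0; congr (F _ ^+ 2).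
  by rewrite /X /vec_of_coord !linearD !linearZ.
rewrite -line; last exact: differentiable_metric2_derive.
have nU : \forall s \near (0 : R), U (p + s *: inr_row u).
  have cl : {for (0 : R), continuous (fun s : R => p + s *: inr_row u)}.
    apply: cvgD; first exact: cvg_cst.
    by apply: cvgZl; exact: cvg_id.
  apply: cl; rewrite scale0r addr0; apply: open_nbhs_nbhs; split=> //.
  exact: open_slit_dom.
rewrite !derive1E; apply: near_eq_derive; apply: filterS nU => s Us.
under eq_fun do rewrite HL.
exact: line (differentiable_metric2 Us).
Qed.

Lemma fundamental_mx_posdef p (u : 'rV[R]_n) : U p -> u != 0 ->
  0 < \sum_i \sum_j u 0 i * (u 0 j * g p i j).
Proof.
move=> Up u0; have [cp p2] := Up.
have cx : chart_dom c (chart_inv c p.1) by exact: chart_dom_inv.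
have Vy := vec_of_coord_inj atlas_c cx p2.
have Vu := vec_of_coord_inj atlas_c cx u0.
have := finsler_posdef finslerF Vy Vu.
rewrite fundamental_form_coord //.
have -> : 'D_(inr_row u) ('D_(inr_row u) L) p =
    \sum_j u 0 j * \sum_i u 0 i * 'D_(dy R i) ('D_(dy R j) L) p.
  rewrite deriveE; last exact: differentiable_metric2_derive.
  rewrite derive_metric2_expand //; apply: eq_bigr => j _; congr (_ * _).
  exact: (diff_linear_expand _ _ (differentiable_metric2_derive _ Up)).
congr (_ < _); rewrite exchange_big mulr_sumr; apply: eq_bigr => j _ /=.
rewrite !mulr_sumr; apply: eq_bigr => i _.
by rewrite fundamental_mxE; ring.
Qed.

Lemma fundamental_mx_unit p : U p -> g p \in unitmx.
Proof.
move=> Up; rewrite -row_free_unit -kermx_eq0; apply/negPn/negP => /rowV0Pn[u].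
rewrite sub_kermx => /eqP ug u0.
have := fundamental_mx_posdef Up u0; rewrite lt_neqAle => /andP[/eqP + _]; apply.
rewrite exchange_big big1 // => j _ /=.
under eq_bigr do rewrite mulrCA.
rewrite -mulr_sumr.
have -> : \sum_i u 0 i * g p i j = (u *m g p) 0 j by rewrite mxE.
by rewrite ug mxE mulr0.
Qed.

(** The Euler-Lagrange covector [d/dt (L_(y^l)) - L_(x^l)] of [L = F^2] for a
    curve with position and velocity [p] and acceleration [a]. *)
Definition euler_lagrange (p : E) (a : 'rV[R]_n) l : R :=
  'd ('D_(dy R l) L) p (p.2, a) - 'D_(dx R l) L p.

Lemma euler_lagrangeE p a l : U p -> euler_lagrange p a l =
  spray_covector p l + 2 * (a *m g p) 0 l.
Proof.
move=> Up; rewrite /euler_lagrange pair_inl_inr linearD.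
have dD := differentiable_metric2_derive (dy R l) Up.
rewrite !(diff_linear_expand _ _ dD) /spray_covector addrAC; congr (_ + _).
rewrite mxE mulr_sumr; apply: eq_bigr => k _.
by rewrite fundamental_mxE [RHS]mulrCA mulVKf // pnatr_eq0.
Qed.

(** The Euler-Lagrange covector is twice the left-hand side of the geodesic
    equation, with its index lowered by the invertible matrix [g]. *)
Lemma geodesic_equationP p (a : 'rV[R]_n) : U p ->
  (forall i, a 0 i +
    \sum_j \sum_k p.2 0 j * p.2 0 k * chern_coef F c i j k p = 0) <->
  (forall l, euler_lagrange p a l = 0).
Proof.
move=> Up; pose S : 'rV[R]_n := \row_l spray_covector p l.
have gU := fundamental_mx_unit Up.
have gT : (invmx (g p))^T = invmx (g p).
  rewrite trmx_inv; congr invmx; apply/matrixP => i j; rewrite mxE.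
  exact: fundamental_mx_sym.
have HL l : euler_lagrange p a l = (S + 2 *: (a *m g p)) 0 l.
  by rewrite euler_lagrangeE // !mxE.
have HC i : a 0 i + \sum_j \sum_k p.2 0 j * p.2 0 k * chern_coef F c i j k p =
    (a + 2^-1 *: (S *m invmx (g p))) 0 i.
  rewrite chern_contract // !mxE; congr (_ + _ * _).
  apply: eq_bigr => l _; rewrite [S 0 l]mxE mulrC; congr (_ * _).
  by rewrite -[in RHS]gT [RHS]mxE.
have two0 : (2 : R) != 0 by rewrite pnatr_eq0.
split=> H.
  have /eqP : a + 2^-1 *: (S *m invmx (g p)) = 0.
    by apply/rowP => i; rewrite -HC H mxE.
  rewrite addr_eq0 => /eqP Ea l; rewrite HL Ea mulNmx -scalemxAl mulmxKV //.
  by rewrite scalerN scalerA mulfV // scale1r subrr mxE.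
have /eqP : S + 2 *: (a *m g p) = 0 by apply/rowP => l; rewrite -HL H mxE.
rewrite addr_eq0 => /eqP ES i; rewrite HC ES mulNmx -scalemxAl mulmxK //.
by rewrite scalerN scalerA mulVf // scale1r subrr mxE.
Qed.

End FinslerCoordinates.

(** * Left translations and left-invariant fields *)

Section Translations.
Context {R : realType} {n : nat} {G : lieGroupType R n}.
Implicit Types (c : chart R n G) (g h x : G) (p q v : 'rV[R]_n).

(** For [g = 1] this is the change of charts from [c1] to [c2]; so [tangent_map]
    of a left translation, [vec_to_coord] and [vec_of_coord] are all differentials
    of such maps. *)
Definition translate c1 c2 g q : 'rV[R]_n := c2 (g * chart_inv c1 q)%g.

Definition translate_dom c1 c2 g : set 'rV[R]_n :=
  [set q | chart_codom c1 q /\ chart_dom c2 (g * chart_inv c1 q)%g].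

Definition mul_coord c1 c2 c3 (p : 'rV[R]_n * 'rV[R]_n) : 'rV[R]_n :=
  c3 (chart_inv c1 p.1 * chart_inv c2 p.2)%g.

Definition mul_coord_dom c1 c2 c3 : set ('rV[R]_n * 'rV[R]_n) :=
  [set p | [/\ chart_codom c1 p.1, chart_codom c2 p.2 &
               chart_dom c3 (chart_inv c1 p.1 * chart_inv c2 p.2)%g]].

Lemma open_mul_coord_dom c1 c2 c3 : open (mul_coord_dom c1 c2 c3).
Proof.
rewrite openE => -[p q] [/= cp cq cpq]; rewrite /interior.
have c1p : {for (p, q), continuous (fun z : 'rV[R]_n * 'rV[R]_n => chart_inv c1 z.1)}.
  apply: (@continuous_comp _ _ _ fst (chart_inv c1)); first exact: cvg_fst.
  exact: chart_inv_continuous.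
have c2q : {for (p, q), continuous (fun z : 'rV[R]_n * 'rV[R]_n => chart_inv c2 z.2)}.
  apply: (@continuous_comp _ _ _ snd (chart_inv c2)); first exact: cvg_snd.
  exact: chart_inv_continuous.
have cm : {for (p, q), continuous (fun z : 'rV[R]_n * 'rV[R]_n =>
    (chart_inv c1 z.1 * chart_inv c2 z.2)%g)}.
  apply: (@continuous_comp _ _ _
    (fun z : 'rV[R]_n * 'rV[R]_n => (chart_inv c1 z.1, chart_inv c2 z.2))
    (fun z : G * G => (z.1 * z.2)%g)); last exact: mulg_continuous.
  exact: cvg_pair.
have n1 : \forall z \near (p, q), chart_codom c1 z.1.
  by apply: cvg_fst; apply: open_nbhs_nbhs; split=> //; exact: open_chart_codom.
have n2 : \forall z \near (p, q), chart_codom c2 z.2.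
  by apply: cvg_snd; apply: open_nbhs_nbhs; split=> //; exact: open_chart_codom.
have n3 := cm _ (near_chart_dom cpq).
by apply: filterS3 n1 n2 n3 => z a b d; split.
Qed.

Lemma smooth_mul_coord c1 c2 c3 : atlas c1 -> atlas c2 -> atlas c3 ->
  smooth_on (mul_coord_dom c1 c2 c3) (mul_coord c1 c2 c3).
Proof. by move=> a1 a2 a3; exact: mulg_smooth. Qed.

Lemma translate_preimage c1 c2 g :
  translate_dom c1 c2 g =
  (fun q => (chart_at g g, q)) @^-1` mul_coord_dom (chart_at g) c1 c2.
Proof.
have gg := chart_at_dom g.
apply/seteqP; split=> q /=.
  by move=> [c1q gq]; split=> //; [exact: chart_codom_map|rewrite chart_mapK].
by move=> [_ c1q]; rewrite chart_mapK.
Qed.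

Lemma open_translate_dom c1 c2 g : open (translate_dom c1 c2 g).
Proof.
rewrite translate_preimage; apply: open_comp; last exact: open_mul_coord_dom.
move=> q _; apply: differentiable_continuous.
exact: (@ex_diff _ _ _ _ _ _ _ (is_diff_pairr _ _)).
Qed.

(** Left translation by [g] is the multiplication with its first argument frozen
    at the coordinates of [g]. *)
Lemma smooth_translate c1 c2 g : atlas c1 -> atlas c2 ->
  smooth_on (translate_dom c1 c2 g) (translate c1 c2 g).
Proof.
move=> a1 a2 k; rewrite translate_preimage.
have -> : translate c1 c2 g =
    fun q => mul_coord (chart_at g) c1 c2 (chart_at g g, q).
  apply/funext => q; rewrite /mul_coord /= chart_mapK //; exact: chart_at_dom.
apply: (Ck_on_affine_precomp (A := fun v => (0, v))).
- exact: open_mul_coord_dom.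
- by move=> q; exact: (@ex_diff _ _ _ _ _ _ _ (is_diff_pairr _ _)).
- by move=> q v; rewrite (@diff_val _ _ _ _ _ _ _ (is_diff_pairr _ _)).
- by apply: smooth_mul_coord => //; exact: chart_at_atlas.
Qed.

Lemma differentiable_translate c1 c2 g q : atlas c1 -> atlas c2 ->
  translate_dom c1 c2 g q -> differentiable (translate c1 c2 g) q.
Proof. by move=> a1 a2; apply: smooth_on_differentiable; exact: smooth_translate. Qed.

(** The product is a variable [k] of its own because it mostly occurs in a
    simplified form, such as 1 for [g^-1 * g]. *)
Lemma diff_translateM c1 c2 c3 g h k q v : (h * g)%g = k ->
  atlas c1 -> atlas c2 -> atlas c3 ->
  translate_dom c1 c2 g q -> chart_dom c3 (h * (g * chart_inv c1 q))%g ->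
  'd (translate c1 c3 k) q v =
  'd (translate c2 c3 h) (translate c1 c2 g q) ('d (translate c1 c2 g) q v).
Proof.
move=> <- a1 a2 a3 gq hgq.
have d1 := differentiable_translate a1 a2 gq.
have d2 : differentiable (translate c2 c3 h) (translate c1 c2 g q).
  have [_ gq2] := gq.
  apply: differentiable_translate => //; split; first exact: chart_codom_map.
  by rewrite /translate chart_mapK.
apply: etrans _ (diff_chain v d1 d2).
have nq : \forall q \near q,
    translate c2 c3 h (translate c1 c2 g q) = translate c1 c3 (h * g)%g q.
  apply: (open_eq_near (@open_translate_dom c1 c2 g)) gq => q' [_ gq'].
  by rewrite /translate chart_mapK // mulgA.
have [_ E] := near_eq_diff nq (differentiable_comp d1 d2).
exact: (congr1 (@^~ v) E).
Qed.

Lemma diff_translate1 c q v : chart_codom c q -> 'd (translate c c 1%g) q v = v.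
Proof.
move=> cq.
have nq : \forall q \near q, idfun q = translate c c 1%g q.
  apply: (open_eq_near (@open_chart_codom _ _ _ c)) cq => q' cq'.
  by rewrite /translate mul1g chart_invK.
have [_ E] := near_eq_diff nq (@ex_diff _ _ _ _ _ _ _ (is_diff_id q)).
by apply: etrans (congr1 (@^~ v) E) _; rewrite diff_val.
Qed.

End Translations.

Section LeftFields.
Context {R : realType} {n : nat} {G : lieGroupType R n}.
Implicit Types (c : chart R n G) (g h x : G) (p q v : 'rV[R]_n).

Notation c1 := (chart_at (1%g : G)).
Notation e := (chart_at (1%g : G) (1%g : G)).

Lemma atlas_unit : atlas c1. Proof. exact: chart_at_atlas. Qed.

Lemma chart_unit_dom : chart_dom c1 (1%g : G). Proof. exact: chart_at_dom. Qed.

Lemma chart_unit_codom : chart_codom c1 e.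
Proof. exact: chart_codom_map chart_unit_dom. Qed.

Lemma chart_unit_inv : chart_inv c1 e = 1%g.
Proof. exact: chart_mapK chart_unit_dom. Qed.

Lemma translate_dom_unit c g : chart_dom c g -> translate_dom c1 c g e.
Proof.
by move=> cg; split; [exact: chart_unit_codom|rewrite chart_unit_inv mulg1].
Qed.

Lemma translate_unit c g : translate c1 c g e = c g.
Proof. by rewrite /translate chart_unit_inv mulg1. Qed.

(** The left-invariant vector field of [Z], in the coordinates of the chart [c]. *)
Definition left_field c (Z : lie_algebra G) p : 'rV[R]_n :=
  'd (translate c1 c (chart_inv c p)) e Z.

Lemma left_fieldD c (Y Z : lie_algebra G) p :
  left_field c (Y + Z) p = left_field c Y p + left_field c Z p.
Proof. exact: linearD. Qed.

Lemma left_fieldZ c (a : R) (Z : lie_algebra G) p :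
  left_field c (a *: Z) p = a *: left_field c Z p.
Proof. exact: linearZ. Qed.

(** As a partial differential of the multiplication at [(p, e)] the field is
    visibly smooth in [p]. *)
Lemma left_fieldE c (Z : lie_algebra G) p : atlas c -> chart_codom c p ->
  left_field c Z p = 'd (mul_coord c c1 c) (p, e) (0, Z).
Proof.
move=> ac cp.
have d1 := @ex_diff _ _ _ _ _ _ _ (is_diff_pairr p e).
have d2 : differentiable (mul_coord c c1 c) (p, e).
  apply: (smooth_on_differentiable (smooth_mul_coord ac atlas_unit ac)).
  split=> //=; first exact: chart_unit_codom.
  by rewrite chart_unit_inv mulg1; exact: chart_dom_inv.
have E := @diff_val _ _ _ _ _ _ _ (is_diff_pairr p e).
exact: etrans (diff_chain Z d1 d2)
  (congr1 ('d (mul_coord c c1 c) (p, e)) (congr1 (@^~ Z) E)).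
Qed.

Lemma smooth_left_field c (Z : lie_algebra G) : atlas c ->
  smooth_on (chart_codom c) (left_field c Z).
Proof.
move=> ac k; have oc := @open_chart_codom _ _ _ c.
apply: (Ck_on_eq oc (f := fun p => 'd (mul_coord c c1 c) (p, e) (0, Z))).
  by move=> p cp; rewrite left_fieldE.
have odom := @open_mul_coord_dom _ _ G c c1 c.
have [_ /(_ (0, Z)) Hk] := smooth_mul_coord ac atlas_unit ac k.+1.
apply: Ck_on_sub (Ck_on_affine_precomp (a := fun p => (p, e)) (A := fun v => (v, 0)) odom _ _ Hk).
- move=> p cp; split=> //=; first exact: chart_unit_codom.
  by rewrite chart_unit_inv mulg1; exact: chart_dom_inv.
- by move=> p; exact: (@ex_diff _ _ _ _ _ _ _ (is_diff_pairl _ _)).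
- by move=> p v; rewrite (@diff_val _ _ _ _ _ _ _ (is_diff_pairl _ _)).
Qed.

(** The identity [L_g L_x = L_(gx)], differentiated at the unit. *)
Lemma left_field_translate c g q (Z : lie_algebra G) : atlas c ->
  translate_dom c1 c g q ->
  left_field c Z (translate c1 c g q) =
  'd (translate c1 c g) q (left_field c1 Z q).
Proof.
move=> ac [cq cgq]; rewrite /left_field {2}/translate chart_mapK //.
set x := chart_inv c1 q in cgq *.
have c1x : chart_dom c1 x by exact: chart_dom_inv.
have d1 : translate_dom c1 c1 x e by exact: translate_dom_unit.
have d2 : chart_dom c (g * (x * chart_inv c1 e))%g.
  by rewrite chart_unit_inv mulg1.
apply: etrans (diff_translateM Z erefl atlas_unit atlas_unit ac d1 d2) _.
have Eq : translate c1 c1 x e = q by rewrite translate_unit chart_invK.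
exact: (congr1 (fun q => 'd (translate c1 c g) q _) Eq).
Qed.

Lemma diff_translate_inj c c' g q v : atlas c -> atlas c' ->
  translate_dom c c' g q -> 'd (translate c c' g) q v = 0 -> v = 0.
Proof.
move=> ac ac' dq; have [cq cgq] := dq.
have d2 : chart_dom c (g^-1 * (g * chart_inv c q))%g.
  by rewrite mulKg; exact: chart_dom_inv.
have E := diff_translateM v (mulVg g) ac ac' ac dq d2.
move=> E0; apply: etrans (esym (diff_translate1 v cq)) (etrans E _).
exact: etrans (congr1 _ E0) (linear0 _).
Qed.

Lemma left_field_neq0 c p (Z : lie_algebra G) : atlas c -> chart_codom c p ->
  Z != 0 -> left_field c Z p != 0.
Proof.
move=> ac cp; apply: contra_neq => E.
apply: diff_translate_inj (atlas_unit) ac _ E.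
by apply: translate_dom_unit; exact: chart_dom_inv.
Qed.

(** The preimage of [w] is found by translating it back to the unit. *)
Lemma left_field_surj c p w : atlas c -> chart_codom c p ->
  exists Z : lie_algebra G, left_field c Z p = w.
Proof.
move=> ac cp; set g := chart_inv c p.
have cg : chart_dom c g by exact: chart_dom_inv.
have d1 : translate_dom c c1 (g^-1)%g p.
  by split=> //; rewrite mulVg; exact: chart_unit_dom.
exists ('d (translate c c1 (g^-1)%g) p w).
have d2 : chart_dom c (g * (g^-1 * chart_inv c p))%g by rewrite mulVKg.
have E := diff_translateM w (mulgV g) ac atlas_unit ac d1 d2.
have Ep : translate c c1 (g^-1)%g p = e by rewrite /translate mulVg.
apply: etrans (etrans _ (esym E)) (diff_translate1 w cp).
exact: (congr1 (fun q => 'd (translate c1 c g) q _) (esym Ep)).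
Qed.

Lemma left_invariant_field_coord c x (Z : lie_algebra G) : atlas c ->
  chart_dom c x -> vec_to_coord c (left_invariant_field Z x) = left_field c Z (c x).
Proof.
move=> ac cx.
rewrite /vec_to_coord /left_invariant_field /tangent_map /left_field.
rewrite chart_mapK //.
have -> : c \o chart_inv (chart_at x) = translate (chart_at x) c 1%g.
  by apply/funext => q; rewrite /translate mul1g.
have d1 : translate_dom c1 (chart_at x) x e.
  by apply: translate_dom_unit; exact: chart_at_dom.
have d2 : chart_dom c (1 * (x * chart_inv c1 e))%g.
  by rewrite chart_unit_inv mulg1 mul1g.
have E := diff_translateM Z (mul1g x) atlas_unit (chart_at_atlas x) ac d1 d2.
apply: etrans _ (esym E).
have Ex : forall y : G, y = x ->
    'd (chart_at y \o left_translation x \o chart_inv c1) e Z =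
    'd (translate c1 (chart_at x) x) e Z.
  by move=> y ->.
apply: etrans (congr1 _ (Ex _ (mulg1 x))) _.
exact: (congr1 (fun q => 'd (translate (chart_at x) c 1%g) q _)
  (esym (translate_unit (chart_at x) x))).
Qed.

Lemma left_field_unit (Z : lie_algebra G) : left_field c1 Z e = Z.
Proof.
rewrite /left_field; apply: etrans _ (diff_translate1 Z chart_unit_codom).
exact: (congr1 (fun x => 'd (translate c1 c1 x) e Z) chart_unit_inv).
Qed.

Lemma lie_bracketE (X Z : lie_algebra G) : lie_bracket X Z =
  'd (left_field c1 Z) e X - 'd (left_field c1 X) e Z.
Proof.
have key (Y : lie_algebra G) p : chart_codom c1 p ->
    left_field c1 Y p = vec_to_coord c1 (left_invariant_field Y (chart_inv c1 p)).
  move=> cp; have cx := chart_dom_inv cp.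
  apply: etrans _ (esym (left_invariant_field_coord Y atlas_unit cx)).
  exact: (congr1 (left_field c1 Y) (esym (chart_invK cp))).
have oc := @open_chart_codom _ _ _ c1.
have D (Y W : lie_algebra G) :
    'D_(vec_to_coord c1 (left_invariant_field W (chart_inv c1 e)))
      (fun p => vec_to_coord c1 (left_invariant_field Y (chart_inv c1 p))) e =
    'd (left_field c1 Y) e W.
  have E0 := etrans (esym (key W e chart_unit_codom)) (left_field_unit W).
  apply: etrans (congr1 (fun v => 'D_v _ e) E0) _.
  rewrite -deriveE; last first.
    apply: smooth_on_differentiable (smooth_left_field _ atlas_unit) _.
    exact: chart_unit_codom.
  apply/esym/near_eq_derive; apply: (open_eq_near oc) chart_unit_codom.
  exact: key.
exact: (congr2 (fun a b => a - b) (D Z X) (D X Z)).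
Qed.

End LeftFields.

(** * The Euler-Lagrange equation of a left-invariant metric *)

Section LeftFieldBracket.
Context {R : realType} {n : nat} {G : lieGroupType R n}.

(** Translation by [chart_inv c p] relates the left-invariant fields near the
    unit to those near [p], and the bracket in a Lie algebra is taken at the unit. *)
Lemma left_field_bracket (c : chart R n G) (p : 'rV[R]_n) (X Z : lie_algebra G) :
  atlas c -> chart_codom c p ->
  'd (left_field c Z) p (left_field c X p)
  - 'd (left_field c X) p (left_field c Z p) =
  left_field c (lie_bracket X Z) p.
Proof.
move=> ac cp.
set c1 := chart_at (1%g : G); set e := chart_at (1%g : G) (1%g : G).
pose g := chart_inv c p; pose phi := translate c1 c g.
have a1 : atlas c1 := @atlas_unit R n G.
have ce : chart_codom c1 e := @chart_unit_codom R n G.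
have dom_e : translate_dom c1 c g e := translate_dom_unit (chart_dom_inv cp).
have phi_e : phi e = p by rewrite /phi translate_unit chart_invK.
have d1 (Y : lie_algebra G) : differentiable (left_field c1 Y) e.
  exact: smooth_on_differentiable (smooth_left_field Y a1) ce.
have d2 (Y : lie_algebra G) : differentiable (left_field c Y) (phi e).
  by apply: smooth_on_differentiable (smooth_left_field Y ac) _; rewrite phi_e.
have rel (Y : lie_algebra G) q : translate_dom c1 c g q ->
    left_field c Y (phi q) = 'd phi q (left_field c1 Y q).
  exact: left_field_translate.
have B := related_bracket (@open_translate_dom _ _ G c1 c g)
  (smooth_translate g a1 ac) dom_e (rel X) (rel Z) (d1 X) (d1 Z) (d2 X) (d2 Z).
rewrite -/phi phi_e !left_field_unit in B.
apply: etrans B _; rewrite /left_field.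
exact: (congr1 ('d phi e) (esym (lie_bracketE X Z))).
Qed.

End LeftFieldBracket.

Lemma vec_of_coord_unit {R : realType} {n : nat} {G : lieGroupType R n}
    (v : 'rV[R]_n) : vec_of_coord (chart_at (1%g : G)) (1%g : G) v = v.
Proof.
apply: etrans _ (diff_translate1 v (@chart_unit_codom R n G)).
apply: (congr1 (fun f => 'd f (chart_at (1%g : G) (1%g : G)) v)).
by apply/funext => q; rewrite /translate mul1g.
Qed.

Fact subr_of_cancelling {R : realType} (t1 t2 t3 t4 k : R) :
  t1 + t2 = 0 -> t3 + t4 = 0 -> t2 - t4 = k -> t1 - t3 = - k.
Proof. by lra. Qed.

Section LeftInvariantMetric.
Context {R : realType} {n : nat} {G : lieGroupType R n}.
Variable F : forall x : G, tangent x -> R.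
Hypotheses (finslerF : is_finsler F) (invF : left_invariant F).

Notation c1 := (chart_at (1%g : G)).
Notation e := (chart_at (1%g : G) (1%g : G)).

(** The vector [left_field c Z p] is the image of [Z] under the translation from
    the unit to the point with coordinates [p], whatever the chart. *)
Lemma coord_metric2_left_field c p (Z : lie_algebra G) :
  atlas c -> chart_codom c p ->
  coord_metric2 F c (p, left_field c Z p) = F (x := 1%g) Z ^+ 2.
Proof.
move=> ac cp; rewrite /coord_metric2 /coord_metric /=; congr (_ ^+ 2).
set x := chart_inv c p; have cx : chart_dom c x by exact: chart_dom_inv.
have H : forall y : G, y = x ->
    F (x := y) ('d (chart_at y \o left_translation x \o chart_inv c1) e Z) =
    F (x := x) ('d (translate c1 (chart_at x) x) e Z).
  by move=> y ->.
apply: etrans _ (invF x Z); apply: etrans _ (esym (H _ (mulg1 x))).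
apply: (congr1 (F (x := x))).
have d1 : translate_dom c1 c x e by exact: translate_dom_unit.
have d2 : chart_dom (chart_at x) (1 * (x * chart_inv c1 e))%g.
  by rewrite chart_unit_inv mulg1 mul1g; exact: chart_at_dom.
have E := diff_translateM Z (mul1g x) (@atlas_unit R n G) ac (chart_at_atlas x) d1 d2.
apply: etrans _ (esym E); rewrite /vec_of_coord.
have -> : chart_at x \o chart_inv c = translate c (chart_at x) 1%g.
  by apply/funext => q; rewrite /translate mul1g.
exact: (congr1 (fun q => 'd (translate c (chart_at x) 1%g) q (left_field c Z p))
  (esym (translate_unit c x))).
Qed.

Variable X : lie_algebra G.
Hypothesis X_neq0 : X != 0.

Lemma slit_dom_left_field c p : atlas c -> chart_codom c p ->
  slit_dom c (p, left_field c X p).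
Proof. by move=> ac cp; split=> //=; exact: left_field_neq0. Qed.

Lemma slit_dom_unit : slit_dom c1 (e, X).
Proof. by split=> //=; exact: chart_unit_codom. Qed.

(** Replace [Z] by [X + s *: Z] in [coord_metric2_left_field] and differentiate
    at [s = 0]. *)
Lemma fiber_derive_left_field c p (Z : lie_algebra G) :
  atlas c -> chart_codom c p ->
  'd (coord_metric2 F c) (p, left_field c X p) (inr_row (left_field c Z p)) =
  'D_(inr_row Z) (coord_metric2 F c1) (e, X).
Proof.
move=> ac cp.
have dL := differentiable_metric2 finslerF ac (slit_dom_left_field ac cp).
have dL1 := differentiable_metric2 finslerF (@atlas_unit R n G) slit_dom_unit.
have H (s : R) : coord_metric2 F c
      ((p, left_field c X p) + s *: inr_row (left_field c Z p)) =
    coord_metric2 F c1 ((e, X) + s *: inr_row Z).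
  have -> : (p, left_field c X p) + s *: inr_row (left_field c Z p) =
      (p, left_field c (X + s *: Z) p).
    by rewrite left_fieldD left_fieldZ; congr pair; rewrite /= scaler0 addr0.
  have -> : (e, X) + s *: inr_row Z = (e, left_field c1 (X + s *: Z) e).
    by rewrite left_field_unit; congr pair; rewrite /= scaler0 addr0.
  rewrite coord_metric2_left_field // coord_metric2_left_field //.
    exact: atlas_unit.
  exact: chart_unit_codom.
have line (L : 'rV[R]_n * 'rV[R]_n -> R) q w : differentiable L q ->
    is_derive (0 : R) 1 (fun s : R => L (q + s *: w)) ('D_w L q).
  move=> dq; have dq0 : differentiable L (q + 0 *: w).
    by rewrite scale0r addr0.
  by have := is_derive_line dq0; rewrite scale0r addr0.
have [_ E1] := line _ _ (inr_row (left_field c Z p)) dL.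
have [_ E2] := line _ _ (inr_row Z) dL1.
apply: etrans (esym (deriveE _ dL)) _; apply: etrans (esym E1) (etrans _ E2).
exact: (congr1 (fun f : R -> R => 'D_(1 : R) f (0 : R)) (funext H)).
Qed.

(** [coord_metric2_left_field] for the field of [X], differentiated in [p]. *)
Lemma base_derive_left_field c p w : atlas c -> chart_codom c p ->
  'd (coord_metric2 F c) (p, left_field c X p)
    (w, 'd (left_field c X) p w) = 0.
Proof.
move=> ac cp.
have dL := differentiable_metric2 finslerF ac (slit_dom_left_field ac cp).
have dX : differentiable (left_field c X) p.
  exact: smooth_on_differentiable (smooth_left_field X ac) cp.
have [dPd dPv] := diff_graph dX.
have nH : \forall q \near p,
    F (x := 1%g) X ^+ 2 = coord_metric2 F c (q, left_field c X q).
  apply: (open_eq_near (@open_chart_codom _ _ _ c)) cp => q cq.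
  by rewrite coord_metric2_left_field.
have [_ E] := near_eq_diff nH (differentiable_cst _ p).
have C := @diff_chain _ _ _ _ (fun q => (q, left_field c X q)) (coord_metric2 F c) p w dPd dL.
apply: etrans (congr1 ('d (coord_metric2 F c) (p, left_field c X p)) (esym (dPv w))) _.
exact: (etrans (esym C) (etrans (congr1 (@^~ w) E) (diff_const _ _ _))).
Qed.

(** On an integral curve of the field of [X] the acceleration is the derivative
    of the field along itself.  Subtract [base_derive_left_field] in the
    direction of the field of [Z] from the derivative of [fiber_derive_left_field]
    along the field of [X]: what does not belong to the Euler-Lagrange covector is
    the fibre derivative along the bracket of the two fields. *)
Lemma euler_lagrange_left_field c p (Z : lie_algebra G) :
  atlas c -> chart_codom c p ->
  let y := left_field c X p in
  \sum_l left_field c Z p 0 l *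
    euler_lagrange F c (p, y) ('d (left_field c X) p y) l =
  - 'D_(inr_row (lie_bracket X Z)) (coord_metric2 F c1) (e, X).
Proof.
move=> ac cp y.
have Up := slit_dom_left_field ac cp.
have oU := @open_slit_dom _ _ _ c.
have sL := smooth_coord_metric2 finslerF ac.
have dL := differentiable_metric2 finslerF ac Up.
have dX : differentiable (left_field c X) p.
  exact: smooth_on_differentiable (smooth_left_field X ac) cp.
have dZ : differentiable (left_field c Z) p.
  exact: smooth_on_differentiable (smooth_left_field Z ac) cp.
have [dPd dPv] := diff_graph dX.
pose a := 'd (left_field c X) p y.
have [_ A] := @diff_along _ _ _ _ (slit_dom c) (coord_metric2 F c)
  (@inr_row R n) (fun q => (q, left_field c X q)) (left_field c Z) p y
  oU sL Up dPd dZ.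
have nC : \forall q \near p, 'D_(inr_row Z) (coord_metric2 F c1) (e, X) =
    'd (coord_metric2 F c) (q, left_field c X q) (inr_row (left_field c Z q)).
  apply: (open_eq_near (@open_chart_codom _ _ _ c)) cp => q cq.
  by rewrite fiber_derive_left_field.
have [_ E] := near_eq_diff nC (differentiable_cst _ p).
have E0 := etrans (esym A) (etrans (congr1 (@^~ y) E) (diff_const _ _ _)).
have A1 := congr1 ('d ('D_(inr_row (left_field c Z p)) (coord_metric2 F c)) (p, y)) (dPv y).
have S1 := derive_metric2_expand finslerF ac (left_field c Z p) (y, a) Up.
have S2 : \sum_l left_field c Z p 0 l * 'D_(dx R l) (coord_metric2 F c) (p, y) =
    'd (coord_metric2 F c) (p, y) (inl_row (left_field c Z p)).
  by rewrite (diff_linear_expand _ _ dL).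
have B := base_derive_left_field (left_field c Z p) ac cp.
pose dLz := 'd (coord_metric2 F c) (p, y).
pose b := 'd (left_field c X) p (left_field c Z p).
have H1 : 'd ('D_(inr_row (left_field c Z p)) (coord_metric2 F c)) (p, y) (y, a)
    + dLz (inr_row ('d (left_field c Z) p y)) = 0.
  exact: etrans (congr1 (+%R^~ _) (esym A1)) E0.
have H2 : dLz (inl_row (left_field c Z p)) + dLz (inr_row b) = 0.
  apply: etrans (esym (linearD _ _ _)) _.
  exact: etrans (congr1 dLz (esym (pair_inl_inr _ _))) B.
have K := fiber_derive_left_field (lie_bracket X Z) ac cp.
have H3 : dLz (inr_row ('d (left_field c Z) p y)) - dLz (inr_row b) =
    'D_(inr_row (lie_bracket X Z)) (coord_metric2 F c1) (e, X).
  apply: etrans (esym (linearB _ _ _)) (etrans _ K).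
  apply: (congr1 dLz); apply: etrans (esym (linearB _ _ _)) _.
  exact: (congr1 (@inr_row R n) (left_field_bracket X Z ac cp)).
apply: etrans _ (subr_of_cancelling H1 H2 H3).
apply: etrans _ (congr2 (fun t s : R => t - s) (esym S1) S2).
by rewrite -sumrB; apply: eq_bigr => l _; rewrite -mulrBr.
Qed.

(** By Euler's identity the fibre derivative of [F^2 / 2] at [X] is
    [g_X (X, _)]; and the left-invariant fields span the tangent space at [p]. *)
Lemma euler_lagrange_bracketP c p : atlas c -> chart_codom c p ->
  let y := left_field c X p in
  (forall l, euler_lagrange F c (p, y) ('d (left_field c X) p y) l = 0) <->
  (forall Z : lie_algebra G,
     fundamental_form F (x := 1%g) X X (lie_bracket X Z) = 0).
Proof.
move=> ac cp y.
have FF (Z : lie_algebra G) : fundamental_form F (x := 1%g) X X Z =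
    2^-1 * 'D_(inr_row Z) (coord_metric2 F c1) (e, X).
  have H := fundamental_form_coord finslerF (@atlas_unit R n G) X Z slit_dom_unit.
  have D2 : 'D_(inr_row X) ('D_(inr_row Z) (coord_metric2 F c1)) (e, X) =
      'D_(inr_row Z) (coord_metric2 F c1) (e, X).
    apply: etrans (deriveE _ _) _.
      exact: (differentiable_metric2_derive finslerF (@atlas_unit R n G) _ slit_dom_unit).
    exact: (euler_metric2_derive finslerF (@atlas_unit R n G) _ slit_dom_unit).
  apply: etrans _ (etrans H (congr1 (GRing.mul 2^-1) D2)).
  have unit_vec : forall x : G, x = 1%g ->
      fundamental_form F (x := x) (vec_of_coord c1 x X) (vec_of_coord c1 x X)
        (vec_of_coord c1 x Z) =
      fundamental_form F (x := 1%g) X X Z.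
    move=> x ->; exact: (congr2
      (fun u v : tangent (1%g : G) => fundamental_form F (x := 1%g) u u v)
      (vec_of_coord_unit X) (vec_of_coord_unit Z)).
  exact: (esym (unit_vec _ (@chart_unit_inv R n G))).
split=> [H Z|H].
  rewrite FF -[X in _ * X]opprK -(euler_lagrange_left_field Z ac cp).
  by rewrite big1 ?oppr0 ?mulr0 // => l _; rewrite H mulr0.
move=> l; have [Z HZ] := left_field_surj (delta_mx 0 l) ac cp.
have := euler_lagrange_left_field Z ac cp.
rewrite /= HZ (bigD1 l) //= mxE !eqxx mul1r big1 ?addr0 => [->|k kl].
  have /eqP := H Z; rewrite FF mulf_eq0 invr_eq0 pnatr_eq0 /= => /eqP ->.
  exact: oppr0.
by rewrite mxE (negPf kl) mul0r.
Qed.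

End LeftInvariantMetric.

(** * One-parameter subgroups *)

Section LocalHomomorphisms.
Context {R : realType} {G : groupType}.
Local Open Scope group_scope.

Lemma homomorphism0 (gamma : R -> G) :
  (forall s t, gamma (s + t)%R = gamma s * gamma t) -> gamma 0%R = 1.
Proof.
move=> hom; apply: (mulgI (gamma 0%R)).
by rewrite -hom addr0 mulg1.
Qed.

Lemma homomorphism_expg (gamma : R -> G) :
  (forall s t, gamma (s + t)%R = gamma s * gamma t) ->
  forall (k : nat) t, gamma (t *+ k)%R = gamma t ^+ k.
Proof.
move=> hom; elim=> [|k IH] t; first by rewrite mulr0n (homomorphism0 hom) expg0.
by rewrite mulrS hom IH expgS.
Qed.

Variables (gamma : R -> G) (eta : R).
Hypothesis eta_gt0 : (0 < eta)%R.
Hypothesis local_hom : forall s t : R, (`|s| < eta)%R -> (`|t| < eta)%R ->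
  gamma (s + t)%R = gamma s * gamma t.

Let dyadic (t : R) (k : nat) : R := (t / 2 ^+ k)%R.
Let small t k := (`|dyadic t k| < eta)%R.

Let smallS t k : small t k -> small t k.+1.
Proof.
rewrite /small /dyadic !normrM !normfV exprS normrM invfM => h.
apply: le_lt_trans h; rewrite mulrCA ler_piMl ?mulr_ge0 ?invr_ge0 //.
by rewrite ger0_norm // invf_le1 // ler1n.
Qed.

Let small_leq t k m : (k <= m)%N -> small t k -> small t m.
Proof. by move=> /subnK <- h; elim: (m - k)%N => // i; exact: smallS. Qed.

Let small_exists t : exists k, small t k.
Proof.
have := @upper_nthrootP R (`|t| / eta)%R _ (leqnn _).
set k := Num.bound _ => tk; exists k; rewrite /small /dyadic normrM normfV.
rewrite (ger0_norm (exprn_ge0 _ _)) // ltr_pdivrMr ?exprn_gt0 //.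
by rewrite mulrC -ltr_pdivrMr.
Qed.

Let dyadic_power t k := gamma (dyadic t k) ^+ (2 ^ k)%N.

Let dyadic_powerS t k : small t k -> dyadic_power t k.+1 = dyadic_power t k.
Proof.
move=> /smallS h; rewrite /dyadic_power.
have -> : dyadic t k = (dyadic t k.+1 + dyadic t k.+1)%R.
  by rewrite /dyadic exprS; field; rewrite expf_neq0 // pnatr_eq0.
by rewrite local_hom // expnS expgnA expg2.
Qed.

Let dyadic_power_leq t k m : (k <= m)%N -> small t k ->
  dyadic_power t m = dyadic_power t k.
Proof.
move=> /subnK <- h; elim: (m - k)%N => // i IH.
by rewrite addSn dyadic_powerS // (small_leq _ h) // leq_addl.
Qed.

(** The value at [t] is [gamma (t / 2 ^+ k) ^+ (2 ^ k)], which is the same for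
    all large [k].  It is additive in [t] because values at small times commute:
    their products in both orders are [gamma] at the sum of the times. *)
Lemma local_homomorphism_extends : exists Gamma : R -> G,
  (forall s t, Gamma (s + t)%R = Gamma s * Gamma t) /\
  (forall t, (`|t| < eta)%R -> Gamma t = gamma t).
Proof.
have /choice[K HK] := small_exists.
exists (fun t => dyadic_power t (K t)); split=> [s t|t t_small].
  pose m := maxn (K (s + t)%R) (maxn (K s) (K t)).
  have ks : (K s <= m)%N by rewrite !leq_max leqnn orbT.
  have kt : (K t <= m)%N by rewrite !leq_max leqnn !orbT.
  have kst : (K (s + t)%R <= m)%N by rewrite leq_max leqnn.
  rewrite -(dyadic_power_leq kst (HK _)) -(dyadic_power_leq ks (HK _)).
  rewrite -(dyadic_power_leq kt (HK _)) /dyadic_power.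
  have ss := small_leq ks (HK s); have st := small_leq kt (HK t).
  have -> : dyadic (s + t)%R m = (dyadic s m + dyadic t m)%R by rewrite /dyadic mulrDl.
  rewrite local_hom // expgMn // /commute -local_hom // addrC.
  exact: local_hom.
have s0 : small t 0%N by rewrite /small /dyadic expr0 divr1.
rewrite (dyadic_power_leq (leq0n _) s0) /dyadic_power /dyadic.
by rewrite expr0 divr1 expn0 expg1.
Qed.

End LocalHomomorphisms.

Section OneParameterSubgroups.
Context {R : realType} {n : nat} {G : lieGroupType R n}.
Implicit Types (X Z : lie_algebra G) (gamma delta : R -> G).

Notation c1 := (chart_at (1%g : G)).
Notation e := (chart_at (1%g : G) (1%g : G)).

(** One-parameter subgroups with the least regularity that determines them:
    differentiability at 0, in one chart. *)
Definition flow_subgroup X gamma : Prop :=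
  [/\ forall s t, gamma (s + t) = (gamma s * gamma t)%g,
      {for (0 : R), continuous gamma} &
      is_derive (0 : R) 1 (c1 \o gamma) (X : 'rV[R]_n)].

Section FlowTheory.
Variables (X : lie_algebra G) (gamma : R -> G).
Hypothesis flow : flow_subgroup X gamma.

Let hom s t : gamma (s + t) = (gamma s * gamma t)%g.
Proof. by have [] := flow. Qed.

Let gamma0 : gamma 0 = 1%g. Proof. exact: homomorphism0 hom. Qed.

Lemma flow_subgroup_continuous : continuous gamma.
Proof.
move=> t; have [_ c0 _] := flow.
have Eg : gamma = fun s => (gamma t * gamma (s - t))%g.
  by apply/funext => s; rewrite -hom subrKC.
have cs : {for t, continuous (fun s : R => gamma (s - t))}.
  apply: (@continuous_comp _ _ _ (fun s : R => s - t) gamma).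
    by apply: cvgB; [exact: cvg_id|exact: cvg_cst].
  by rewrite subrr.
have cp : {for t, continuous (fun s : R => (gamma t, gamma (s - t)))}.
  by apply: cvg_pair; [exact: cvg_cst|exact: cs].
have := @continuous_comp _ _ _ (fun s : R => (gamma t, gamma (s - t)))
  (fun z : G * G => (z.1 * z.2)%g) t cp (@mulg_continuous R n G _).
by rewrite /comp /= -Eg.
Qed.

(** Near [t] the curve is its initial piece translated by [gamma t]. *)
Lemma is_derive_flow (c : chart R n G) (t : R) : atlas c ->
  chart_dom c (gamma t) ->
  is_derive t 1 (c \o gamma) (left_field c X (c (gamma t))).
Proof.
move=> ac ct; have [_ _ d0] := flow.
have H0 : is_derive (- t + t * 1) 1 (c1 \o gamma) (X : 'rV[R]_n).
  by rewrite mulr1 addNr.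
have := is_derive_affine H0; rewrite scale1r => H1.
set x := fun s : R => (c1 \o gamma) (- t + s * 1) in H1.
have xt : x t = e by rewrite /x /= mulr1 addNr gamma0.
have dx : differentiable x t by apply/derivable1_diffP; have [] := H1.
have a1 := @atlas_unit R n G.
have dphi : differentiable (translate c1 c (gamma t)) (x t).
  rewrite xt; apply: differentiable_translate => //.
  exact: translate_dom_unit.
have near_dom : \forall s \near t, chart_dom c1 (gamma (- t + s * 1)).
  have cl : {for t, continuous (fun s : R => gamma (- t + s * 1))}.
    apply: (@continuous_comp _ _ _ (fun s : R => - t + s * 1) gamma).
      apply: cvgD; first exact: cvg_cst.
      by apply: cvgMl; exact: cvg_id.
    exact: flow_subgroup_continuous.
  apply: cl; rewrite mulr1 addNr gamma0; apply: near_chart_dom.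
  exact: chart_unit_dom.
have nE : \forall s \near t, translate c1 c (gamma t) (x s) = (c \o gamma) s.
  apply: filterS near_dom => s ds; rewrite /translate /x /= chart_mapK //.
  by rewrite -hom mulr1 addrA subrr add0r.
have D : 'd (translate c1 c (gamma t)) (x t) (X : 'rV[R]_n) =
    left_field c X (c (gamma t)).
  apply: etrans (congr1 (fun q => 'd (translate c1 c (gamma t)) q X) xt) _.
  exact: (congr1 (fun g => 'd (translate c1 c g) e X) (esym (chart_mapK ct))).
apply: is_derive_eq (near_eq_is_derive nE (is_derive_chain H1 dphi)) D.
Qed.

(** For smooth [h] the derivative of [h] along the curve is the Lie derivative of
    [h] along the curve, which is of the same kind; so [h] along the curve is C^k
    for all [k] by induction, for all [h] at once. *)
Lemma smooth_flow (c : chart R n G) : atlas c ->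
  smooth_on (gamma @^-1` chart_dom c) (c \o gamma).
Proof.
move=> ac.
have oJ : open (gamma @^-1` chart_dom c).
  apply: open_comp; last exact: open_chart_dom.
  by move=> t _; exact: flow_subgroup_continuous.
have oc := @open_chart_codom _ _ _ c.
have dx t : chart_dom c (gamma t) -> differentiable (c \o gamma) t.
  by move=> ct; apply/derivable1_diffP; have [] := is_derive_flow ac ct.
have key k : forall h : 'rV[R]_n -> R, smooth_on (chart_codom c) h ->
    Ck_on k (gamma @^-1` chart_dom c) (fun t => h (c (gamma t))).
  elim: k => [|k IH] h sh.
    move=> t ct; apply: (@continuous_comp _ _ _ (c \o gamma) h).
      exact: differentiable_continuous (dx t ct).
    exact: smooth_on_continuous sh (chart_codom_map ct).
  have dh t : chart_dom c (gamma t) -> differentiable h ((c \o gamma) t).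
    by move=> ct; exact: smooth_on_differentiable sh (chart_codom_map ct).
  split=> [t ct|v]; first exact: differentiable_comp (dx t ct) (dh t ct).
  have sL := smooth_on_lie_derivative oc sh (smooth_left_field X ac).
  apply: (Ck_on_eq oJ (f := fun t => v * 'd h (c (gamma t)) (left_field c X (c (gamma t))))).
    move=> t ct; have [_ Ed] := is_derive_flow ac ct.
    have dc := is_derive_chain (is_derive_flow ac ct) (dh t ct).
    have dhc := differentiable_comp (dx t ct) (dh t ct).
    have [_ Eh] := dc; rewrite deriveE // in Eh.
    by rewrite -Eh -[v in RHS]mulr1 -[v * 1 in RHS]/(v *: 1) linearZ.
  apply: Ck_onM => //; first exact: Ck_on_cst.
  exact: IH sL.
move=> k; apply: Ck_on_row => // j.
exact: (key k (@row_coord R n j) (smooth_row_coord j oc)).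
Qed.

Lemma flow_smooth_curve : smooth_curve_on setT gamma.
Proof.
split=> [t _|c ac]; first exact: flow_subgroup_continuous.
by rewrite setTI; exact: smooth_flow.
Qed.

Lemma velocity_flow (t : R) :
  velocity gamma t = left_field (chart_at (gamma t)) X (chart_at (gamma t) (gamma t)).
Proof.
have [_] := is_derive_flow (chart_at_atlas (gamma t)) (chart_at_dom (gamma t)).
by rewrite -derive1E.
Qed.

Lemma flow_one_parameter_subgroup : one_parameter_subgroup X gamma.
Proof.
split=> //; first exact: flow_smooth_curve.
have H : forall x : G, x = 1%g ->
    left_field (chart_at x) X (chart_at x x) = (X : 'rV[R]_n).
  by move=> x ->; exact: left_field_unit.
by rewrite velocity_flow; exact: H.
Qed.

Lemma flow_scale (a : R) : flow_subgroup (a *: X) (fun s => gamma (s * a)).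
Proof.
have [_ _ d0] := flow; split.
- by move=> s t; rewrite mulrDl hom.
- apply: (@continuous_comp _ _ _ (fun s : R => s * a) gamma).
    by apply: cvgMl; exact: cvg_id.
  exact: flow_subgroup_continuous.
- have H0 : is_derive (0 + 0 * a) 1 (c1 \o gamma) (X : 'rV[R]_n).
    by rewrite mul0r addr0.
  have := is_derive_affine H0.
  by under eq_fun do rewrite add0r.
Qed.

End FlowTheory.

Lemma one_parameter_subgroup_flow X gamma :
  one_parameter_subgroup X gamma -> flow_subgroup X gamma.
Proof.
move=> [[cg sg] hom v0]; split=> //; first exact: cg.
have g0 := homomorphism0 hom.
have g0d : chart_dom c1 (gamma 0) by rewrite g0; exact: chart_unit_dom.
have d0 : differentiable (c1 \o gamma) 0.
  by apply: smooth_on_differentiable (sg c1 (@atlas_unit R n G)) _; split.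
apply: DeriveDef; first exact: diff_derivable.
rewrite -derive1E.
have H : forall x : G, x = 1%g -> derive1 (c1 \o gamma) 0 = derive1 (chart_at x \o gamma) 0.
  by move=> x ->.
exact: etrans (H _ g0) v0.
Qed.

(** Both curves solve the same differential equation in a chart around 1, so they
    agree for small times, and [gamma t] is a power of [gamma (t / N)]. *)
Lemma flow_subgroup_unique X gamma delta :
  flow_subgroup X gamma -> flow_subgroup X delta -> gamma = delta.
Proof.
move=> fg fd.
have a1 := @atlas_unit R n G.
have [r [L [r0 L0 rU VL]]] := locally_lipschitz (@open_chart_codom _ _ _ c1)
  (smooth_left_field X a1) (@chart_unit_codom R n G).
have near_unit (f : R -> G) : flow_subgroup X f ->
    \forall t \near (0 : R), chart_dom c1 (f t) /\ `|c1 (f t) - e| <= r.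
  move=> ff; have [homf c0 d0] := ff; have f0 := homomorphism0 homf.
  have n1 : \forall t \near (0 : R), chart_dom c1 (f t).
    by apply: c0; rewrite f0; apply: near_chart_dom; exact: chart_unit_dom.
  have cc : {for (0 : R), continuous (c1 \o f)}.
    by apply: differentiable_continuous; apply/derivable1_diffP; have [] := d0.
  have n2 := near_dist_le cc r0.
  apply: filterS2 n1 n2 => t dt; rewrite /= f0 distrC => rt; by split.
have [d d0 Hd] := near_norm_ball (filterI (near_unit _ fg) (near_unit _ fd)).
have in_ball (t : R) : `|t| < d -> `|t - 0| < d by rewrite subr0.
have agree (t : R) : `|t| < d -> gamma t = delta t.
  move=> td; have [[g1 _] [d1 _]] := Hd _ (in_ball t td).
  rewrite -[LHS](chart_mapK g1) -[RHS](chart_mapK d1); congr (chart_inv c1 _).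
  apply: (@solution_unique _ _ [set p | `|p - e| <= r] (left_field c1 X) L d
    (c1 \o gamma) (c1 \o delta) L0) td => //.
  - move=> s sd; have [[gs rs] _] := Hd _ (in_ball s sd); split=> //.
    exact: is_derive_flow.
  - move=> s sd; have [_ [ds rs]] := Hd _ (in_ball s sd); split=> //.
    exact: is_derive_flow.
  - have [homg _ _] := fg; have [homd _ _] := fd.
    by rewrite /= (homomorphism0 homg) (homomorphism0 homd).
apply/funext => t.
pose N := (Num.bound (`|t| / d)).+1.
have N0 : 0 < N%:R :> R by rewrite ltr0n.
have tN : `|t / N%:R| < d.
  rewrite normrM normfV (ger0_norm (ltW N0)) ltr_pdivrMr // mulrC -ltr_pdivrMr //.
  apply: lt_le_trans (archi_boundP _) _; first by rewrite divr_ge0 // ltW.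
  by rewrite ler_nat.
have -> : t = (t / N%:R) *+ N by rewrite -[RHS]mulr_natr divfK // gt_eqF.
have [homg _ _] := fg; have [homd _ _] := fd.
by rewrite (homomorphism_expg homg) (homomorphism_expg homd) agree.
Qed.

(** For a fixed small [s] the curves [gamma0 s * gamma0 t] and [gamma0 (s + t)]
    solve the same equation with the same initial value, since the field is
    left-invariant; so the local solution is a local homomorphism. *)
Lemma flow_subgroup_exists X : exists gamma, flow_subgroup X gamma.
Proof.
have a1 := @atlas_unit R n G.
have oc := @open_chart_codom _ _ _ c1.
have ce := @chart_unit_codom R n G.
have sV := smooth_left_field X a1.
have [r [L [r0 L0 rU VL]]] := locally_lipschitz oc sV ce.
have [x [x0 dx]] := local_solution_exists oc sV ce.
have cx : {for (0 : R), continuous x}.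
  apply: differentiable_continuous; apply/derivable1_diffP.
  by have [] := nbhs_singleton dx.
have nx : \forall s \near (0 : R), is_derive (s : R) 1 x (left_field c1 X (x s)) /\ `|x s - e| <= r.
  have n2 := near_dist_le cx r0.
  by apply: filterS2 dx n2 => s ds; rewrite x0 distrC.
pose xx (z : R * R) := (x z.1, x z.2).
have cxx : {for ((0 : R), (0 : R)), continuous xx}.
  have cx1 : {for ((0 : R), (0 : R)), continuous (fun z : R * R => x z.1)}.
    by apply: (@continuous_comp _ _ _ fst x); [exact: cvg_fst|exact: cx].
  have cx2 : {for ((0 : R), (0 : R)), continuous (fun z : R * R => x z.2)}.
    by apply: (@continuous_comp _ _ _ snd x); [exact: cvg_snd|exact: cx].
  exact: (cvg_pair cx1 cx2).
have Dee : mul_coord_dom c1 c1 c1 (xx (0, 0)).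
  rewrite /xx /= x0; split=> //=; rewrite chart_unit_inv mulg1.
  exact: chart_unit_dom.
have oD := @open_mul_coord_dom R n G c1 c1 c1.
have nD : \forall z \near ((0 : R), (0 : R)), mul_coord_dom c1 c1 c1 (xx z).
  by apply: cxx; exact: open_nbhs_nbhs.
have nr : \forall z \near ((0 : R), (0 : R)), `|mul_coord c1 c1 c1 (xx z) - e| <= r.
  have cm : {for ((0 : R), (0 : R)), continuous (mul_coord c1 c1 c1 \o xx)}.
    apply: continuous_comp; first exact: cxx.
    exact: smooth_on_continuous (smooth_mul_coord a1 a1 a1) Dee.
  have := near_dist_le cm r0; apply: filterS => z.
  rewrite /= distrC /xx /= x0 {2}/mul_coord /= chart_unit_inv mulg1.
  by [].
have n1 : \forall z \near ((0 : R), (0 : R)),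
    is_derive (z.1 : R) 1 x (left_field c1 X (x z.1)) /\ `|x z.1 - e| <= r.
  exact: cvg_fst nx.
have [d d0 Hd] := near_norm_ball (filterI n1 (filterI nD nr)).
have Hz (s t : R) : `|s| < d -> `|t| < d -> `|(s, t) - ((0 : R), (0 : R))| < d.
  by move=> sd td; rewrite prod_normE /= !subr0 gt_max sd td.
pose gamma0 (t : R) : G := chart_inv c1 (x t).
pose eta := d / 2.
have eta0 : 0 < eta by rewrite divr_gt0.
have eta_d : eta < d by rewrite ltr_pdivrMr // ltr_pMr // ltr1n.
have local_hom (s t : R) : `|s| < eta -> `|t| < eta ->
    gamma0 (s + t) = (gamma0 s * gamma0 t)%g.
  move=> s_eta t_eta; have sd := lt_trans s_eta eta_d; have td := lt_trans t_eta eta_d.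
  have [_ [[_ _ Dst] _]] := Hd _ (Hz _ _ sd td); rewrite /= in Dst.
  rewrite -(chart_mapK Dst); congr (chart_inv c1 _).
  pose y := fun u : R => translate c1 c1 (gamma0 s) (x u).
  pose z := fun u : R => x (s + u * 1).
  have H := @solution_unique _ _ [set p | `|p - e| <= r] (left_field c1 X) L eta
    z y L0.
  have -> : x (s + t) = z t by rewrite /z mulr1.
  apply: H t_eta.
  - by move=> p q; exact: VL.
  - move=> u u_eta; have sud : `|s + u * 1| < d.
      rewrite mulr1; apply: le_lt_trans (ler_normD _ _) _.
      by rewrite [ltRHS](splitr d) ltrD.
    have [[dsu rsu] _] := Hd _ (Hz _ _ sud td); split; first exact: rsu.
    by have := is_derive_affine dsu; rewrite scale1r.
  - move=> u u_eta; have ud := lt_trans u_eta eta_d.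
    have [_ [[_ cu Dsu] rsu]] := Hd _ (Hz _ _ sd ud); split; first exact: rsu.
    have [[du _] _] := Hd _ (Hz _ _ ud td).
    have dsu : translate_dom c1 c1 (gamma0 s) (x u) by split.
    have dtr := differentiable_translate a1 a1 dsu.
    apply: is_derive_eq (is_derive_chain du dtr) _.
    exact: esym (left_field_translate X a1 dsu).
  - have [_ [[cs _ _] _]] := Hd _ (Hz _ _ sd td).
    rewrite /z /y mul0r addr0 x0 translate_unit /gamma0 chart_invK //.
have [gamma [hom Eg]] := local_homomorphism_extends eta0 local_hom.
have near_gamma : \forall t \near (0 : R), gamma0 t = gamma t.
  have : \forall t \near (0 : R), `|t| < eta.
    by apply: (@near_norm_lt _ _ _ (fun t : R => t)); [exact: cvg_id|rewrite normr0].
  by apply: filterS => t /Eg.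
exists gamma; split=> //.
- have c0 : {for (0 : R), continuous gamma0}.
    apply: (@continuous_comp _ _ _ x (chart_inv c1)) => //.
    by rewrite x0; exact: chart_inv_continuous.
  move=> A; rewrite /= -(nbhs_singleton near_gamma) => /c0 gA.
  by apply: filterS2 near_gamma gA => t /= ->.
- have near_x : \forall t \near (0 : R), x t = (c1 \o gamma) t.
    apply: filterS2 near_gamma nx => t Et [_ /rU ct].
    by rewrite /= -Et /gamma0 chart_invK.
  have := nbhs_singleton dx; rewrite x0 left_field_unit => dx0.
  exact: (near_eq_is_derive near_x dx0).
Qed.

Lemma lie_expE X gamma : flow_subgroup X gamma -> lie_exp X = gamma 1.
Proof.
move=> fX; rewrite /lie_exp.
have P : [set gamma 1 | gamma in one_parameter_subgroup X] (gamma 1).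
  by exists gamma => //; exact: flow_one_parameter_subgroup.
have [delta /one_parameter_subgroup_flow fd <-] := xgetPex 1%g (ex_intro _ _ P).
by rewrite (flow_subgroup_unique fd fX).
Qed.

(** [s |-> gamma (s * t)] is the one-parameter subgroup of [t *: X]. *)
Lemma lie_exp_line X gamma : flow_subgroup X gamma ->
  (fun t : R => lie_exp (t *: X)) = gamma.
Proof.
move=> fX; apply/funext => t.
by rewrite (lie_expE (flow_scale fX t)) mul1r.
Qed.

End OneParameterSubgroups.

Lemma flow_geodesic_equationP {R : realType} {n : nat} {G : lieGroupType R n}
    (F : forall x : G, tangent x -> R) (X : lie_algebra G) (gamma : R -> G)
    (c : chart R n G) (t : R) :
  is_finsler F -> left_invariant F -> X != 0 -> flow_subgroup X gamma ->
  atlas c -> chart_dom c (gamma t) ->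
  let x := c \o gamma in
  let x' := derive1 x in
  let x'' := derive1 x' in
  (forall i, x'' t 0 i + \sum_j \sum_k x' t 0 j * x' t 0 k *
     chern_coef F c i j k (x t, x' t) = 0) <->
  (forall Z : lie_algebra G,
     fundamental_form F (x := 1%g) X X (lie_bracket X Z) = 0).
Proof.
move=> finslerF invF X_neq0 flow ac ct x x' x''.
have cp : chart_codom c (x t) := chart_codom_map ct.
pose y := left_field c X (x t).
have Ex' s : chart_dom c (gamma s) -> x' s = left_field c X (x s).
  by move=> cs; have [_ <-] := is_derive_flow flow ac cs; exact: derive1E.
have near_dom : \forall s \near t, chart_dom c (gamma s).
  by apply: (flow_subgroup_continuous flow); exact: near_chart_dom.
have dX : differentiable (left_field c X) (x t).
  exact: smooth_on_differentiable (smooth_left_field X ac) cp.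
have Ex'' : x'' t = 'd (left_field c X) (x t) y.
  have [_ <-] := is_derive_chain (is_derive_flow flow ac ct) dX.
  by apply: etrans (derive1E _ _) _; apply: near_eq_derive; apply: filterS near_dom.
have Up := slit_dom_left_field X_neq0 ac cp.
rewrite (Ex' _ ct) Ex''.
apply: iff_trans (euler_lagrange_bracketP finslerF invF X_neq0 ac cp).
exact: (geodesic_equationP finslerF ac _ Up).
Qed.

Theorem theorem3p2 (R : realType) (n : nat) (G : lieGroupType R n)
    (connG : connected [set: G])
    (F : forall x : G, tangent x -> R)
    (finslerF : is_finsler F) (invF : left_invariant F)
    (X : lie_algebra G) (X_neq0 : X != 0) :
  is_geodesic_vector F X <->
  (forall Z : lie_algebra G,
     fundamental_form F (x := 1%g) X X (lie_bracket X Z) = 0).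
Proof.
have [gamma flow] := flow_subgroup_exists X.
rewrite /is_geodesic_vector (lie_exp_line flow).
have equation c t := flow_geodesic_equationP finslerF invF X_neq0 flow
  (c := c) (t := t).
split=> [[_ geo]|bracket0].
  have [] := geo 0; first by rewrite /= in_itv /= lexx.
  move=> _ geo0; have ac := chart_at_atlas (gamma 0).
  have ct := chart_at_dom (gamma 0).
  exact: ((equation _ _ ac ct).1 (geo0 _ ac ct)).
split.
  exists setT; split=> //; first exact: openT.
  exact: flow_smooth_curve flow.
move=> t _; split.
  rewrite (velocity_flow flow); apply: left_field_neq0 => //.
    exact: chart_at_atlas.
  exact: chart_codom_map (chart_at_dom _).
move=> c ac ct; exact: ((equation c t ac ct).2 bracket0).
Qed.
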